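(* For every POMDP learning problem of the kind described in the context (no further assumption on the POMDP), the Bayesian regret of the PS4POMDPs algorithm satisfies $$\mathrm{BReg}(\phi^{\mathrm{PS4POMDPs}},K)\le \tilde{\mathcal O}\Big(H^2\sqrt{(S^2A+SO)\,(OA)^H\,K}\Big).$$
   Context: A finite-horizon POMDP is a tuple $(\mathscr S,\mathscr A,\mathscr O,H,b_1,T,Z,r)$ with finite state set $\mathscr S$ ($|\mathscr S|=S$), finite action set $\mathscr A$ ($|\mathscr A|=A$), finite observation set $\mathscr O$ ($|\mathscr O|=O$), horizon $H\in\mathbb N$, initial state distribution $b_1\in\Delta(\mathscr S)$, transition kernels $T_h:\mathscr S\times\mathscr A\to\Delta(\mathscr S)$ for $h\in[H-1]$, observation kernels $Z_h:\mathscr S\to\Delta(\mathscr O)$ for $h\in[H]$, and rewards $r_h:\mathscr O\times\mathscr A\to[0,1]$ for $h\in[H]$. A (deterministic) policy $\pi=(\pi_h)_{h=1}^H$ consists of maps $\pi_h:(\mathscr O\times\mathscr A)^{h-1}\times\mathscr O\to\mathscr A$; $\varPi$ is the set of all such policies, and $\pi_h(a\mid\tau_{h-1},o):=\mathbf 1\{\pi_h(\tau_{h-1},o)=a\}$. A trajectory is $\tau=(o_h,a_h)_{h=1}^H\in\mathscr T:=(\mathscr O\times\mathscr A)^H$, and $\tau_h$ denotes its first $h$ observation–action pairs. Its probability under $\pi$ is $\Pr^\pi(\tau)=\pi(\tau)\Pr^-(\tau)$, where $\pi(\tau)=\prod_{h=1}^H\pi_h(a_h\mid\tau_{h-1},o_h)$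 and $\Pr^-(\tau)=\sum_{s_{1:H}\in\mathscr S^H}b_1(s_1)Z_H(o_H\mid s_H)\prod_{h=1}^{H-1}Z_h(o_h\mid s_h)T_h(s_{h+1}\mid s_h,a_h)$. The value of $\pi$ is $V^\pi=\sum_{\tau\in\mathscr T}\Pr^\pi(\tau)\sum_{h=1}^Hr_h(o_h,a_h)$ and $V^*=\max_{\pi\in\varPi}V^\pi$. Learning setting: $\mathscr S,\mathscr A,\mathscr O,H,r$ are known; $(b_1,T,Z)=(b_1^\theta,T^\theta,Z^\theta)$ depends on a parameter $\theta$ in a known Borel parameter set $\varTheta$ via a known measurable parameterization; quantities of the POMDP with parameter $\theta$ carry a subscript $\theta$ ($\Pr^\pi_\theta,\Pr^-_\theta,V^\pi_\theta,V^*_\theta$). The true parameter $\theta^*$ is random with prior $\nu^1\in\Delta(\varTheta)$. In episodes $k=1,2,\dots$, with data $\mathcal D_k=(\tau^j,\pi^j)_{j=1}^{k-1}$, a learning algorithm $\phi=(\phi_k)_k$ draws a policy $\pi^k\sim\phi_k(\mathcal D_k)\in\Delta(\varPi)$, applies it during the whole episode and observes the trajectory $\tau^k\sim\Pr^{\pi^k}_{\theta^*}$. The Bayesian regret over $K$ episodes is $\mathrm{BReg}(\phi,K)=\mathbb E^\phi\big[\sum_{k=1}^K(V^*_{\theta^*}-V^{\pi^k}_{\theta^*})\big]$, the expectation being over $\theta^*\sim\nu^1$, the algorithm's randomness and the trajectories. The PS4POMDPs algorithm: in episode $k$, given the posterior $\nu^k$ ($\nu^1$ = prior), sample $\tilde\theta^k\sim\nu^k$,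 compute (with an exact planner) $\tilde\pi^k\in\arg\max_{\pi\in\varPi}V^\pi_{\tilde\theta^k}$, play $\pi^k=\tilde\pi^k$, observe $\tau^k$, and update by Bayes' rule $\frac{d\nu^{k+1}}{d\nu^k}(\theta)=\Pr^{\tilde\pi^k}_\theta(\tau^k)\big/\int_\varTheta\Pr^{\tilde\pi^k}_{\theta'}(\tau^k)\,d\nu^k(\theta')$. $\tilde{\mathcal O}(\cdot)$ hides absolute constants and logarithmic factors in the problem parameters $S,A,O,H,K$. *)

(* Defs.v *)
From HB Require Import structures.
From mathcomp Require Import all_boot all_order all_algebra.
From mathcomp Require Import all_classical all_reals all_analysis.

Set Implicit Arguments.
Unset Strict Implicit.
Unset Printing Implicit Defensive.

Import Order.TTheory GRing.Theory Num.Theory.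
Local Open Scope classical_set_scope.
Local Open Scope ring_scope.

(* Finite-horizon POMDPs.  States St, actions Ac, observations Ob are finite  *)
(* types; the horizon is H; time steps h = 1..H are represented by 'I_H      *)
(* (ordinal h stands for step h+1).                                          *)

Section POMDP.
Variables (R : realType) (St Ac Ob : finType) (H : nat).

(* the "successor" index h+1 (only used when h.+1 < H) *)
Definition nxt (h : 'I_H) : 'I_H := insubd h h.+1.

Definition traj := {ffun 'I_H -> Ob * Ac}.

Definition nonanticipating (f : {ffun 'I_H * traj * Ob -> Ac}) : bool :=
  [forall h : 'I_H, forall t1 : traj, forall t2 : traj, forall o : Ob,
     [forall j : 'I_H, (j < h)%N ==> (t1 j == t2 j)] ==>
     (f (h, t1, o) == f (h, t2, o))].

Definition policy := {f : {ffun 'I_H * traj * Ob -> Ac} | nonanticipating f}.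

Definition pol_act (pi : policy) (h : 'I_H) (t : traj) (o : Ob) : Ac :=
  (val pi) (h, t, o).

Definition pol_prob (pi : policy) (t : traj) : R :=
  \prod_(h : 'I_H) (pol_act pi h t (t h).1 == (t h).2)%:R.

(* A POMDP model (b_1, T, Z).  T h is only meaningful for h.+1 < H. *)
Record model := Model {
  b1 : St -> R;
  Tk : 'I_H -> St -> Ac -> St -> R;
  Zk : 'I_H -> St -> Ob -> R }.

Definition is_distr (T : finType) (p : T -> R) :=
  (forall x, 0 <= p x) /\ \sum_x p x = 1.

Definition valid_model (m : model) :=
  is_distr (b1 m) /\
  (forall (h : 'I_H) s a, (h.+1 < H)%N -> is_distr (Tk m h s a)) /\
  (forall (h : 'I_H) s, is_distr (Zk m h s)).

Definition Prminus (m : model) (t : traj) : R :=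
  \sum_(s : {ffun 'I_H -> St})
    \prod_(h : 'I_H)
      ((if (h == 0 :> nat) then b1 m (s h) else 1) *
       Zk m h (s h) (t h).1 *
       (if (h.+1 < H)%N then Tk m h (s h) (t h).2 (s (nxt h)) else 1)).

Definition Prpi (m : model) (pi : policy) (t : traj) : R :=
  pol_prob pi t * Prminus m t.

Definition value (r : 'I_H -> Ob -> Ac -> R) (m : model) (pi : policy) : R :=
  \sum_(t : traj) Prpi m pi t * \sum_(h : 'I_H) r h (t h).1 (t h).2.

(* V^* = max_pi V^pi  (values are >= 0 when rewards are, so 0 is a neutral
   default for the maximum over the finite nonempty set of policies) *)
Definition optvalue (r : 'I_H -> Ob -> Ac -> R) (m : model) : R :=
  \big[Num.max/0]_(pi : policy) value r m pi.

End POMDP.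

Section Learning.
Variables (R : realType) (St Ac Ob : finType) (H : nat).
Variables (d : measure_display) (Theta : measurableType d).
Variable nu1 : probability Theta R.
Variable M : Theta -> model R St Ac Ob H.

Definition measurable_param :=
  (forall s, measurable_fun setT (fun th => b1 (M th) s)) /\
  (forall h s a s', measurable_fun setT (fun th => Tk (M th) h s a s')) /\
  (forall h s o, measurable_fun setT (fun th => Zk (M th) h s o)).

Definition episode := (policy Ac Ob H * traj Ac Ob H)%type.

(* Density d nu^{k} / d nu^1 of the posterior after the data D, obtained by  *)
(* iterating Bayes' rule
     d nu^{j+1}/d nu^j (th) = Pr^{pi^j}_th(tau^j) / int Pr^{pi^j}_th'(tau^j) d nu^j(th').
   The data is given in REVERSE chronological order (most recent first).     *)
Fixpoint post_dens_rev (D : seq episode) (th : Theta) : R :=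
  match D with
  | [::] => 1
  | e :: D' =>
      post_dens_rev D' th * Prpi (M th) e.1 e.2 /
      fine (\int[nu1]_(th' in setT)
              (post_dens_rev D' th' * Prpi (M th') e.1 e.2)%:E)
  end.

Definition data (K : nat) (hist : {ffun 'I_K -> episode}) (k : nat) : seq episode :=
  seq.map hist (seq.filter (fun j : 'I_K => (j < k)%N) (enum 'I_K)).

Definition posterior_dens K (hist : {ffun 'I_K -> episode}) (k : nat) (th : Theta) : R :=
  post_dens_rev (rev (data hist k)) th.

Variable planner : Theta -> policy Ac Ob H.
Variable r : 'I_H -> Ob -> Ac -> R.

Definition exact_planner :=
  (forall pi, measurable (planner @^-1` [set pi])) /\
  (forall th pi, value r (M th) pi <= value r (M th) (planner th)).

(* PS4POMDPs: pi^k = planner(th~^k), th~^k ~ nu^k, so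
   Pr(pi^k = pi | D_k) = nu^k(planner^{-1}(pi)). *)
Definition ps_policy_prob K (hist : {ffun 'I_K -> episode}) (k : nat)
  (pi : policy Ac Ob H) : R :=
  fine (\int[nu1]_(th in planner @^-1` [set pi]) (posterior_dens hist k th)%:E).

(* Bayesian regret over K episodes: expectation over th* ~ nu1 and the joint *)
(* law of (pi^1,tau^1,...,pi^K,tau^K) given th*, which is
     prod_k Pr(pi^k | D_k) * Pr^{pi^k}_{th*}(tau^k). *)
Definition BReg_PS (K : nat) : \bar R :=
  \int[nu1]_(ths in setT)
    (\sum_(hist : {ffun 'I_K -> episode})
       (\prod_(k : 'I_K)
          (ps_policy_prob hist k (hist k).1 * Prpi (M ths) (hist k).1 (hist k).2)) *
       \sum_(k : 'I_K) (optvalue r (M ths) - value r (M ths) (hist k).1))%:E.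

End Learning.

(* Main.v *)
(** Information-theoretic analysis of posterior sampling.  Given the data D, the played policy and
    the policy that is optimal for the true parameter have the same law, so the regret of an
    episode is the mean over theta of V_theta - Vbar at the policy optimal for theta, where Vbar
    is the value under the posterior mean q of Pr^-_theta.  For each trajectory t, let p(t) be the
    posterior probability that the played policy is compatible with t.  The elementary inequality
    2 mu (P - q) <= 4 mu^2 + (P ln P - P ln q - P + q) with mu = lam / (2 p(t)) bounds the
    contribution of t by lam + p(t) kl(t) / lam, and the sum over t of p(t) kl(t) is exactly the
    information gained about theta in the episode.  The information telescopes over the episodes,
    and its total is at most 1 + ln N once N models (rational grids on the transition and
    observation kernels) dominate every model up to a factor e over the K episodes.  With
    ln N = O(H (S^2 A + S O) log) and (O A)^H trajectories, the choice of lam gives the bound. *)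

Require Import Defs.
From HB Require Import structures.
From mathcomp Require Import all_boot all_order all_algebra.
From mathcomp Require Import all_classical all_reals all_analysis.
From mathcomp Require Import measurable_realfun ring lra zify.

Import Order.TTheory GRing.Theory Num.Theory.
Local Open Scope classical_set_scope.
Local Open Scope ring_scope.

Set Implicit Arguments.
Unset Strict Implicit.
Unset Printing Implicit Defensive.

(** * Expectations of bounded measurable functions *)

Section Expectation.
Context {R : realType} {d : measure_display} {T : measurableType d}.
Variable nu : probability T R.
Implicit Types f g : T -> R.

Definition bmeas f := measurable_fun setT f /\ exists C, forall t, `|f t| <= C.

(** [fine] loses nothing on [bmeas] functions, which are integrable; [ExE] recovers the
    extended-real integral. *)
Definition Ex f : R := fine (\int[nu]_(t in setT) (f t)%:E).

Lemma bmeas_cst c : bmeas (fun=> c).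
Proof. by split; [exact: measurable_cst | exists `|c|]. Qed.

Lemma bmeasD f g : bmeas f -> bmeas g -> bmeas (fun t => f t + g t).
Proof.
move=> [mf [a fa]] [mg [b gb]]; split; first exact: measurable_funD.
by exists (a + b) => t; rewrite (le_trans (ler_normD _ _))// lerD.
Qed.

Lemma bmeasM f g : bmeas f -> bmeas g -> bmeas (fun t => f t * g t).
Proof.
move=> [mf [a fa]] [mg [b gb]]; split; first exact: measurable_funM.
by exists (a * b) => t; rewrite normrM ler_pM.
Qed.

Lemma bmeasN f : bmeas f -> bmeas (fun t => - f t).
Proof.
move=> bf; rewrite (_ : (fun t => _) = (fun t => -1 * f t)).
  exact: bmeasM (bmeas_cst _) bf.
by apply/funext => t; rewrite mulN1r.
Qed.

Lemma bmeasB f g : bmeas f -> bmeas g -> bmeas (fun t => f t - g t).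
Proof. by move=> bf bg; apply: bmeasD => //; exact: bmeasN. Qed.

Lemma bmeas_sum I (s : seq I) (F : I -> T -> R) :
  (forall i, bmeas (F i)) -> bmeas (fun t => \sum_(i <- s) F i t).
Proof.
move=> bF; elim: s => [|i s IH].
  rewrite (_ : (fun t => _) = fun=> 0); first exact: bmeas_cst.
  by apply/funext => t; rewrite big_nil.
rewrite (_ : (fun t => _) = (fun t => F i t + \sum_(j <- s) F j t)).
  exact: bmeasD.
by apply/funext => t; rewrite big_cons.
Qed.

Lemma bmeas_prod I (s : seq I) (F : I -> T -> R) :
  (forall i, bmeas (F i)) -> bmeas (fun t => \prod_(i <- s) F i t).
Proof.
move=> bF; elim: s => [|i s IH].
  rewrite (_ : (fun t => _) = fun=> 1); first exact: bmeas_cst.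
  by apply/funext => t; rewrite big_nil.
rewrite (_ : (fun t => _) = (fun t => F i t * \prod_(j <- s) F j t)).
  exact: bmeasM.
by apply/funext => t; rewrite big_cons.
Qed.

Lemma bmeas_unit f : measurable_fun setT f -> (forall t, 0 <= f t <= 1) -> bmeas f.
Proof.
move=> mf f01; split=> //; exists 1 => t.
by have /andP[f0 f1] := f01 t; rewrite ger0_norm.
Qed.

Lemma xlnx_ge (x : R) : 0 <= x -> x - 1 <= x * ln x.
Proof.
rewrite le_eqVlt => /predU1P[<-|x0]; first by rewrite ln0 ?mulr0// sub0r lerN10.
rewrite -(ler_pM2l (_ : 0 < x^-1)) ?invr_gt0//.
rewrite mulrA mulVf ?gt_eqF// mul1r mulrBr mulVf ?gt_eqF// mulr1.
have := @le_ln1Dx R (x^-1 - 1); rewrite [1 + _]addrC subrK lnV ?posrE//.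
have : 0 < x^-1 by rewrite invr_gt0.
move=> h /(_ _); lra.
Qed.

(** [xlnx_ge] keeps the values in [[-1, 0]], so entropy integrands stay bounded although [ln] is
    not. *)
Lemma bmeas_xlnx f : bmeas f -> (forall t, 0 <= f t <= 1) ->
  bmeas (fun t => f t * ln (f t)).
Proof.
move=> [mf _] f01; split.
  apply: measurable_funM => //.
  exact: (measurableT_comp (@measurable_ln R)).
exists 1 => t; have /andP[f0 f1] := f01 t.
rewrite ler_norml; apply/andP; split.
  by apply: le_trans (xlnx_ge f0); lra.
rewrite (@le_trans _ _ 0)//; apply: mulr_ge0_le0 => //.
by have [->|fp] := eqVneq (f t) 0; [rewrite ln0 | rewrite ln_le0].
Qed.

Lemma bmeas_integrable f : bmeas f -> nu.-integrable setT (EFin \o f).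
Proof.
move=> [mf [C fC]]; apply: measurable_bounded_integrable => //.
  by rewrite -ge0_fin_numE// fin_num_measure.
exists C; split; first exact: num_real.
by move=> M CM t _; exact: le_trans (fC t) (ltW CM).
Qed.

Lemma ExE f : bmeas f -> (\int[nu]_(t in setT) (f t)%:E = (Ex f)%:E)%E.
Proof.
move=> bf; rewrite /Ex fineK//.
exact: integrable_fin_num (bmeas_integrable bf).
Qed.

Lemma eq_Ex f g : f =1 g -> Ex f = Ex g.
Proof. by move=> fg; congr Ex; apply/funext. Qed.

Lemma ExD f g : bmeas f -> bmeas g -> Ex (fun t => f t + g t) = Ex f + Ex g.
Proof. by move=> bf bg; apply: (@RintegralD _ _ _ nu) => //; exact: bmeas_integrable. Qed.

Lemma ExZ c f : bmeas f -> Ex (fun t => c * f t) = c * Ex f.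
Proof. by move=> bf; apply: (@RintegralZl _ _ _ nu) => //; exact: bmeas_integrable. Qed.

Lemma ExZr c f : bmeas f -> Ex (fun t => f t * c) = Ex f * c.
Proof. by move=> bf; rewrite mulrC -ExZ//; apply: eq_Ex => t; rewrite mulrC. Qed.

Lemma Ex_cst c : Ex (fun=> c) = c.
Proof.
rewrite /Ex integral_cst//= ?probability_setT ?mule1//.
Qed.

(** On an empty space the constants 0 and 1 would be the same function, yet their means differ. *)
Lemma probability_inhabited : exists t : T, True.
Proof.
apply: contrapT => nT; have := Ex_cst 1.
have -> : Ex (fun=> 1) = Ex (fun=> 0) by apply: eq_Ex => t; case: nT; exists t.
by rewrite Ex_cst => /esym/eqP; rewrite oner_eq0.
Qed.

Lemma ExB f g : bmeas f -> bmeas g -> Ex (fun t => f t - g t) = Ex f - Ex g.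
Proof. by move=> bf bg; apply: (@RintegralB _ _ _ nu) => //; exact: bmeas_integrable. Qed.

Lemma Ex_sum I (s : seq I) (F : I -> T -> R) : (forall i, bmeas (F i)) ->
  Ex (fun t => \sum_(i <- s) F i t) = \sum_(i <- s) Ex (F i).
Proof.
move=> bF; elim: s => [|i s IH].
  by rewrite big_nil -[RHS]Ex_cst; apply: eq_Ex => t; rewrite big_nil.
rewrite big_cons -IH -ExD//; last exact: bmeas_sum.
by apply: eq_Ex => t; rewrite big_cons.
Qed.

Lemma le_Ex f g : bmeas f -> bmeas g -> (forall t, f t <= g t) -> Ex f <= Ex g.
Proof.
by move=> bf bg fg; apply: (@le_Rintegral _ _ _ nu) => //; exact: bmeas_integrable.
Qed.

Lemma Ex_ge0 f : (forall t, 0 <= f t) -> 0 <= Ex f.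
Proof. by move=> f0; apply: (@Rintegral_ge0 _ _ _ nu) => ? _. Qed.

(** [f] vanishes almost everywhere, hence so does the product; [g] itself may be unbounded, as the
    logarithm of a likelihood is. *)
Lemma Ex0_mul f g : bmeas f -> bmeas (fun t => f t * g t) -> (forall t, 0 <= f t) ->
  Ex f = 0 -> Ex (fun t => f t * g t) = 0.
Proof.
move=> bf bfg f0 Ef.
have mf : measurable_fun setT (EFin \o f) by apply/measurable_EFinP; case: bf.
have ae0 : ae_eq nu setT (EFin \o f) (cst 0%E).
  apply/ae_eq_integral_abs => //.
  rewrite (_ : (\int[nu]_(x in setT) _)%E = (\int[nu]_(x in setT) (f x)%:E)%E).
    by rewrite ExE// Ef.
  by apply: eq_integral => t _ /=; rewrite ger0_norm.
apply: EFin_inj; rewrite -ExE//.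
rewrite (ae_eq_integral (cst 0%E)) ?integral0//.
  by apply/measurable_EFinP; case: bfg.
apply: filterS ae0 => t /= h _; have [] := h I => ->.
by rewrite mul0r.
Qed.

End Expectation.

(** With [u] and [v] the square roots of [p] and [q], the entropy term is at least [(u - v) ^+ 2],
    because [ln (v / u) <= v / u - 1]. Since [p - q = (u + v) * (u - v)] and [(u + v) ^+ 2 <= 4],
    the square of [mu * (u + v) - (u - v)] being nonnegative concludes. *)
Lemma sub_le_kl (R : realType) (p q mu : R) :
  0 <= p <= 1 -> 0 < q <= 1 ->
  2 * mu * (p - q) <= 4 * mu ^+ 2 + (p * ln p - p * ln q - p + q).
Proof.
move=> /andP[p0 p1] /andP[q0 q1].
pose u := Num.sqrt p; pose v := Num.sqrt q.
have pE : p = u ^+ 2 by rewrite sqr_sqrtr.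
have qE : q = v ^+ 2 by rewrite sqr_sqrtr// ltW.
have u0 : 0 <= u by exact: sqrtr_ge0.
have v0 : 0 < v by rewrite sqrtr_gt0.
have u1 : u <= 1 by rewrite -sqrtr1 ler_wsqrtr.
have v1 : v <= 1 by rewrite -sqrtr1 ler_wsqrtr.
have kl : (u - v) ^+ 2 <= p * ln p - p * ln q - p + q.
  have [up|] := ltP 0 u; last first.
    move=> u_le0; have ue : u = 0 by apply/le_anti; rewrite u_le0 u0.
    by rewrite pE ue qE expr0n/= !mul0r; lra.
  have lnv : ln (v / u) <= v / u - 1.
    have := @le_ln1Dx R (v / u - 1); rewrite [1 + _]addrC subrK; apply.
    by have : 0 < v / u by [exact: divr_gt0]; lra.
  have le2 : u ^+ 2 * ln (v / u) <= u * v - u ^+ 2.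
    have := ler_wpM2l (sqr_ge0 u) lnv.
    suff -> : u ^+ 2 * (v / u - 1) = u * v - u ^+ 2 by [].
    by field; rewrite gt_eqF.
  move: le2; rewrite ln_div ?posrE// pE qE !lnXn//; lra.
have us : (u + v) ^+ 2 <= 4 by nra.
have := sqr_ge0 (mu * (u + v) - (u - v)).
have : mu ^+ 2 * (u + v) ^+ 2 <= 4 * mu ^+ 2 by rewrite mulrC ler_wpM2r// sqr_ge0.
rewrite {1}pE {1}qE; lra.
Qed.

(** * Sums over histories *)

Section HistorySum.
Context {R : realType} {E : finType}.
Implicit Types (g : seq E -> R) (D : seq E).

(* Histories are listed most recent episode first. *)
Fixpoint hsum k g : R :=
  if k is k'.+1 then hsum k' (fun D => \sum_e g (e :: D)) else g [::].

Lemma eq_hsum k g1 g2 : g1 =1 g2 -> hsum k g1 = hsum k g2.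
Proof. by move=> /funext ->. Qed.

Lemma le_hsum k g1 g2 : (forall D, size D = k -> g1 D <= g2 D) -> hsum k g1 <= hsum k g2.
Proof.
elim: k g1 g2 => [|k IH] g1 g2 g12 /=; first exact: g12.
by apply: IH => D sD; apply: ler_sum => e _; apply: g12; rewrite /= sD.
Qed.

Lemma hsumD k g1 g2 : hsum k (fun D => g1 D + g2 D) = hsum k g1 + hsum k g2.
Proof.
elim: k g1 g2 => [|k IH] g1 g2 //=; rewrite -IH; apply: eq_hsum => D.
by rewrite big_split.
Qed.

Lemma hsumZ k c g : hsum k (fun D => c * g D) = c * hsum k g.
Proof.
elim: k g => [|k IH] g //=; rewrite -IH; apply: eq_hsum => D.
by rewrite mulr_sumr.
Qed.

Lemma hsum_sum k (I : finType) (F : I -> seq E -> R) :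
  hsum k (fun D => \sum_i F i D) = \sum_i hsum k (F i).
Proof.
elim: k F => [|k IH] F //=; rewrite -IH; apply: eq_hsum => D.
by rewrite exchange_big.
Qed.

Lemma bmeas_hsum d (T : measurableType d) k (F : seq E -> T -> R) :
  (forall D, bmeas (F D)) -> bmeas (fun t => hsum k (F^~ t)).
Proof.
elim: k F => [|k IH] F bF /=; first exact: bF.
by apply: (IH (fun D t => \sum_e F (e :: D) t)) => D; exact: bmeas_sum.
Qed.

Lemma Ex_hsum d (T : measurableType d) (nu : probability T R) k (F : seq E -> T -> R) :
  (forall D, bmeas (F D)) -> Ex nu (fun t => hsum k (F^~ t)) = hsum k (fun D => Ex nu (F D)).
Proof.
elim: k F => [|k IH] F bF //=.
rewrite (IH (fun D t => \sum_e F (e :: D) t)).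
  by apply: eq_hsum => D; rewrite Ex_sum.
by move=> D; exact: bmeas_sum.
Qed.

(** A function on ['I_K.+1] is a function on ['I_K] together with a value at [ord_max], and the
    reversal puts that last value at the head of the history. *)
Lemma hsum_ffun K g :
  \sum_(h : {ffun 'I_K -> E}) g (rev [seq h i | i <- enum 'I_K]) = hsum K g.
Proof.
elim: K g => [|K IH] g.
  rewrite (big_pred1 [ffun i : 'I_0 => False_rect E (notF (ltn_ord i))]).
    by rewrite (size0nil (size_enum_ord 0)).
  by move=> h; apply/esym/eqP/ffunP => -[].
rewrite /= -IH.
pose snoc (u : {ffun 'I_K -> E} * E) : {ffun 'I_K.+1 -> E} :=
  [ffun i => if unlift ord_max i is Some j then u.1 j else u.2].
pose unsnoc (h : {ffun 'I_K.+1 -> E}) : {ffun 'I_K -> E} * E :=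
  ([ffun j => h (lift ord_max j)], h ord_max).
rewrite (reindex snoc) /=; last first.
  exists unsnoc => [[h e] _|h _]; rewrite /unsnoc /snoc.
    congr pair; last by rewrite ffunE unlift_none.
    by apply/ffunP => j; rewrite !ffunE liftK.
  apply/ffunP => i; rewrite !ffunE/=.
  by case: unliftP => [j|] -> //; rewrite ffunE.
rewrite pair_big /=; apply: eq_bigr => -[h e] _ /=; congr g.
rewrite enum_ordSr map_rcons rev_rcons /snoc ffunE unlift_none/=; congr (_ :: rev _).
rewrite -map_comp; apply: eq_map => j /=; rewrite ffunE.
have -> : widen_ord (leqnSn K) j = lift ord_max j.
  by apply: val_inj; rewrite /= /bump leqNgt ltn_ord.
by rewrite liftK.
Qed.

End HistorySum.

(** * Regret and information gain of posterior sampling *)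

Create HintDb bmeas.
#[local] Hint Resolve bmeas_cst bmeasD bmeasM bmeasN bmeasB bmeas_sum bmeas_prod : bmeas.

Section ThompsonSampling.
Context {R : realType} {d : measure_display} {Theta : measurableType d}.
Variable nu : probability Theta R.
Variables (Pi Tr : finType) (x : Pi -> Tr -> bool).
Variables (P : Theta -> Tr -> R) (sel : Theta -> Pi).
Variables (rho : Tr -> R) (B : R).
Local Notation E := (Pi * Tr)%type.
Local Notation Ex := (Ex nu).

(* x pi t says that pi takes the actions of t when it sees the observations of t, so that
   under pi the trajectory t has probability (x pi t)%:R * P th t.  sel th is a policy
   optimal for th. *)
Fixpoint lik (p : Tr -> R) (D : seq E) : R :=
  if D is e :: D' then lik p D' * ((x e.1 e.2)%:R * p e.2) else 1.

(** The Bayes normalizer: averaged over the prior, the history [D] has probability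
    [pweight D * evid D]. *)
Definition evid D := Ex (fun th => lik (P th) D).

(* Equals 0 for every pi when evid D = 0, and then it is not a distribution; such histories
   have probability 0. *)
Definition psamp D pi := Ex (fun th => (sel th == pi)%:R * lik (P th) D) / evid D.

(** The part of the law of a history that is free of theta: given [th], [D] has probability
    [pweight D * lik (P th) D]. *)
Fixpoint pweight (D : seq E) : R :=
  if D is e :: D' then pweight D' * psamp D' e.1 else 1.

Definition pvalue (p : Tr -> R) pi := \sum_t (x pi t)%:R * p t * rho t.

(* Averaged over the histories of length k, this is the mutual information between theta
   and the first k episodes. *)
Definition infogain D :=
  Ex (fun th => lik (P th) D * ln (lik (P th) D)) - evid D * ln (evid D).

Definition preg th pi := pvalue (P th) (sel th) - pvalue (P th) pi.

Hypothesis P01 : forall th t, 0 <= P th t <= 1.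
Hypothesis mP : forall t, measurable_fun setT (P^~ t).
Hypothesis msel : forall pi, measurable_fun setT (fun th => (sel th == pi)%:R : R).
Hypothesis xP1 : forall th pi, \sum_t (x pi t)%:R * P th t = 1.
Hypothesis rhoB : forall t, 0 <= rho t <= B.
Hypothesis sel_opt : forall th pi, 0 <= preg th pi.

Lemma lik_ge0 (p : Tr -> R) D : (forall t, 0 <= p t) -> 0 <= lik p D.
Proof. by move=> p0; elim: D => //= e D IH; rewrite !mulr_ge0. Qed.

Lemma likP01 th D : 0 <= lik (P th) D <= 1.
Proof.
elim: D => /= [|e D /andP[l0 l1]]; first by rewrite ler01 lexx.
have /andP[p0 p1] := P01 th e.2.
rewrite !mulr_ge0//= !mulr_ile1// ?mulr_ge0// ?mulr_ile1//; by case: x.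
Qed.

Let likP0 th D : 0 <= lik (P th) D.
Proof. by have /andP[] := likP01 th D. Qed.

Let P0 th t : 0 <= P th t.
Proof. by have /andP[] := P01 th t. Qed.

Let bP t : bmeas (P^~ t).
Proof. by apply: bmeas_unit => // th; exact: P01. Qed.

Let bsel pi : bmeas (fun th => (sel th == pi)%:R : R).
Proof. by apply: bmeas_unit => // th; case: (sel th == pi); rewrite ?lexx ?ler01. Qed.

Let blik D : bmeas (fun th => lik (P th) D).
Proof. by elim: D => /= [|e D IH]; auto with bmeas. Qed.

Let bliklnlik D : bmeas (fun th => lik (P th) D * ln (lik (P th) D)).
Proof. by apply: bmeas_xlnx => // th; exact: likP01. Qed.

Let bPlnP t : bmeas (fun th => P th t * ln (P th t)).
Proof. by apply: bmeas_xlnx => // th; exact: P01. Qed.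

Lemma sum_sel th (f : Pi -> R) : \sum_pi (sel th == pi)%:R * f pi = f (sel th).
Proof.
rewrite (bigD1 (sel th))//= eqxx mul1r big1 ?addr0// => pi.
by rewrite eq_sym => /negbTE ->; rewrite mul0r.
Qed.

Lemma bmeas_sel (F : Pi -> Theta -> R) : (forall pi, bmeas (F pi)) ->
  bmeas (fun th => F (sel th) th).
Proof.
move=> bF; rewrite (_ : (fun th => _) = fun th => \sum_pi (sel th == pi)%:R * F pi th).
  by auto with bmeas.
by apply/funext => th; rewrite (sum_sel th (F^~ th)).
Qed.

Let bxsel t : bmeas (fun th => (x (sel th) t)%:R : R).
Proof. by apply: (bmeas_sel (F := fun pi _ => (x pi t)%:R)) => pi; exact: bmeas_cst. Qed.

#[local] Hint Resolve bP bsel blik bliklnlik bPlnP bxsel : bmeas.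

Lemma evid_ge0 D : 0 <= evid D.
Proof. exact: Ex_ge0. Qed.

Lemma psamp_ge0 D pi : 0 <= psamp D pi.
Proof. by rewrite divr_ge0 ?evid_ge0 ?Ex_ge0// => th; rewrite mulr_ge0. Qed.

Lemma pweight_ge0 D : 0 <= pweight D.
Proof. by elim: D => //= e D IH; rewrite mulr_ge0 ?psamp_ge0. Qed.

Lemma psamp0 D pi : evid D = 0 -> psamp D pi = 0.
Proof. by rewrite /psamp => ->; rewrite invr0 mulr0. Qed.

(** Probability matching: given the data, the sampled policy has the law of [sel th] under the
    posterior. *)
Lemma sum_psampM D (f : Pi -> R) : evid D != 0 ->
  evid D * \sum_pi psamp D pi * f pi = Ex (fun th => f (sel th) * lik (P th) D).
Proof.
move=> m0; transitivity (\sum_pi Ex (fun th => f pi * ((sel th == pi)%:R * lik (P th) D))).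
  rewrite mulr_sumr; apply: eq_bigr => pi _.
  rewrite ExZ; last by auto with bmeas.
  by rewrite /psamp; field.
rewrite -Ex_sum; last by auto with bmeas.
apply: eq_Ex => th; rewrite -(sum_sel th f) mulr_suml.
by apply: eq_bigr => pi _; ring.
Qed.

Lemma sum_psamp D : evid D != 0 -> \sum_pi psamp D pi = 1.
Proof.
move=> m0; apply: (mulfI m0); rewrite mulr1.
transitivity (evid D * \sum_pi psamp D pi * 1).
  by congr (_ * _); apply: eq_bigr => pi _; rewrite mulr1.
by rewrite (sum_psampM (fun=> 1))//; apply: eq_Ex => th; rewrite mul1r.
Qed.

Lemma sum_psamp_le1 D : \sum_pi psamp D pi <= 1.
Proof.
have [m0|/sum_psamp ->//] := eqVneq (evid D) 0.
by rewrite big1// => pi _; rewrite psamp0.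
Qed.

(** * Regret and information gain of a single episode *)

Section Step.
Variable D : seq E.
Hypothesis m_gt0 : 0 < evid D.

Let L th := lik (P th) D.
Let m := evid D.
Let mn0 : m != 0. Proof. by rewrite gt_eqF. Qed.

(** [q] is the posterior mean of [P th], and [kl t] is [m] times the posterior mean of
    [P th t * ln (P th t / q t)]. The factor [m] is kept because the regret is later summed over
    histories with these weights. *)
Let p t := \sum_pi psamp D pi * (x pi t)%:R.
Let q t := Ex (fun th => L th * P th t) / m.
Let kl t := Ex (fun th => L th * (P th t * ln (P th t))) - m * q t * ln (q t).

Let bL : bmeas L. Proof. exact: blik. Qed.
Let L0 th : 0 <= L th. Proof. exact: likP0. Qed.
Let bLlnL : bmeas (fun th => L th * ln (L th)). Proof. exact: bliklnlik. Qed.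
#[local] Hint Resolve bL bLlnL : bmeas.

Let mq t : m * q t = Ex (fun th => L th * P th t).
Proof. by rewrite /q mulrC divfK. Qed.

Let q01 t : 0 <= q t <= 1.
Proof.
rewrite divr_ge0 ?evid_ge0 ?Ex_ge0//=; last by move=> th; rewrite mulr_ge0.
rewrite ler_pdivrMr// mul1r; apply: le_Ex; [by auto with bmeas..|] => th.
by rewrite ler_piMr//; have /andP[] := P01 th t.
Qed.

Let p_ge0 t : 0 <= p t.
Proof. by apply: sumr_ge0 => pi _; rewrite mulr_ge0 ?psamp_ge0. Qed.

Let mp t : m * p t = Ex (fun th => (x (sel th) t)%:R * L th).
Proof. exact: (sum_psampM (fun pi => (x pi t)%:R)). Qed.

Let sum_xq pi : \sum_t (x pi t)%:R * q t = 1.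
Proof.
apply: (mulfI mn0); rewrite mulr1 mulr_sumr.
transitivity (\sum_t Ex (fun th => (x pi t)%:R * (L th * P th t))).
  apply: eq_bigr => t _; rewrite ExZ; last by auto with bmeas.
  by rewrite -mq; ring.
rewrite -Ex_sum; last by auto with bmeas.
apply: eq_Ex => th; rewrite -[RHS]mulr1 -[X in _ = _ * X](xP1 th pi) mulr_sumr.
by apply: eq_bigr => t _; rewrite /L; ring.
Qed.

Let lnM0 (a b : R) : 0 <= a -> 0 <= b ->
  a * b * ln (a * b) = b * (a * ln a) + a * (b * ln b).
Proof.
rewrite le_eqVlt => /predU1P[<-|a0]; first by rewrite !mul0r mulr0 add0r.
rewrite le_eqVlt => /predU1P[<-|b0]; first by rewrite mulr0 !mul0r mulr0 add0r.
by rewrite lnM//; ring.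
Qed.

(** The new likelihood is [L th * P th t] if [pi] is compatible with [t] and zero otherwise, and the
    new evidence is [m * q t] or zero. [lnM0] splits both entropy terms into an old and a new
    part. *)
Let infogain_cons pi t : infogain ((pi, t) :: D) = (x pi t)%:R *
  (Ex (fun th => P th t * (L th * ln (L th))) - q t * (m * ln m) + kl t).
Proof.
rewrite /infogain /evid /=; case: (x pi t); last first.
  rewrite mul0r (_ : Ex _ = 0); last first.
    by rewrite -[RHS](Ex_cst nu 0); apply: eq_Ex => th; rewrite !mul0r mulr0 mul0r.
  rewrite (_ : Ex _ = 0) ?mul0r ?subr0//.
  by rewrite -[RHS](Ex_cst nu 0); apply: eq_Ex => th; rewrite mul0r mulr0.
rewrite mul1r.
under [X in X - _ = _]eq_Ex => th do rewrite mul1r lnM0//.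
rewrite ExD; [|by auto with bmeas..].
under [X in _ - X * _ = _]eq_Ex => th do rewrite mul1r.
under [X in _ - _ * ln X = _]eq_Ex => th do rewrite mul1r.
rewrite -mq lnM0 ?evid_ge0//; last by have /andP[] := q01 t.
by rewrite /kl /m; ring.
Qed.

(** Chain rule for mutual information. Under every policy both [P th] and [q] have total mass one,
    so the old parts of [infogain_cons] add up to [infogain D]; summing the new parts over policies
    produces [p t]. *)
Lemma infogain_step :
  \sum_(e : E) psamp D e.1 * infogain (e :: D) - infogain D = \sum_t p t * kl t.
Proof.
transitivity (\sum_pi \sum_t psamp D pi * infogain ((pi, t) :: D) - infogain D).
  by rewrite pair_bigA; congr (_ - _); apply: eq_bigr => -[].
rewrite (eq_bigr (fun pi => psamp D pi * (infogain D + \sum_t (x pi t)%:R * kl t))); last first.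
  move=> pi _; rewrite -mulr_sumr; congr (_ * _).
  under eq_bigr do rewrite infogain_cons mulrDr mulrBr.
  rewrite big_split sumrB/=; congr (_ - _ + _).
    transitivity (Ex (fun th => \sum_t (x pi t)%:R * (P th t * (L th * ln (L th))))).
      rewrite Ex_sum; last by auto 10 with bmeas.
      by apply: eq_bigr => t _; rewrite ExZ//; auto with bmeas.
    apply: eq_Ex => th; rewrite -[RHS]mul1r -[X in _ = X * _](xP1 th pi) mulr_suml.
    by apply: eq_bigr => t _; rewrite mulrA.
  rewrite -[RHS]mul1r -[X in _ = X * _](sum_xq pi) mulr_suml.
  by apply: eq_bigr => t _; exact: mulrA.
under eq_bigr do rewrite mulrDr.
rewrite big_split/= -mulr_suml sum_psamp// mul1r addrAC subrr add0r.
under eq_bigr do rewrite mulr_sumr.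
rewrite exchange_big/=; apply: eq_bigr => t _.
by rewrite mulr_suml; apply: eq_bigr => pi _; rewrite mulrA.
Qed.

(** The terms [- P th t + q t] cancel in the mean; they are inserted so that the integrand is the
    one in [sub_le_kl]. *)
Let ExkE t : Ex (fun th => L th * (P th t * ln (P th t) - P th t * ln (q t) - P th t + q t)) = kl t.
Proof.
transitivity (Ex (fun th => L th * (P th t * ln (P th t)) - (ln (q t) + 1) * (L th * P th t) + q t * L th)).
  by apply: eq_Ex => th; ring.
rewrite ExD ?ExB ?ExZ; [|by auto 10 with bmeas..].
by rewrite -mq /kl -/(evid D) -/m; ring.
Qed.

(** This averages [sub_le_kl] at [mu = 0]. If [q t = 0], then [L th * P th t] vanishes almost
    everywhere and so does the entropy term. *)
Let kl_ge0 t : 0 <= kl t.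
Proof.
have /andP[q0 q1] := q01 t.
have [qz|qn0] := eqVneq (q t) 0.
  rewrite /kl qz mulr0 mul0r subr0.
  rewrite (_ : Ex _ = Ex (fun th => (L th * P th t) * ln (P th t))); last first.
    by apply: eq_Ex => th; rewrite mulrA.
  rewrite Ex0_mul//; [by auto with bmeas| |by move=> th; rewrite mulr_ge0|by rewrite -mq qz mulr0].
  rewrite (_ : (fun th => _) = (fun th => L th * (P th t * ln (P th t)))); first by auto with bmeas.
  by apply/funext => th; rewrite mulrA.
rewrite -ExkE; apply: Ex_ge0 => th; rewrite mulr_ge0//.
have := @sub_le_kl R (P th t) (q t) 0 (P01 th t).
by rewrite lt0r qn0 q0 q1 mulr0 mul0r expr0n mulr0 add0r; apply.
Qed.

(** Up to the factor [m], the left side is the posterior covariance of [P th t] with the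
    compatibility of [sel th] with [t]. The bound averages [sub_le_kl] over the parameters for which
    [sel th] is compatible with [t]. *)
Let cross t lam : 0 < lam ->
  Ex (fun th => (x (sel th) t)%:R * L th * P th t) - m * p t * q t
    <= lam * m + p t * kl t / lam.
Proof.
move=> lam0; have /andP[q0 q1] := q01 t.
have bound0 : 0 <= lam * m + p t * kl t / lam.
  by rewrite addr_ge0// ?divr_ge0 ?mulr_ge0 ?kl_ge0 ?p_ge0 ?ltW.
have X_le (f g : Theta -> R) : bmeas f -> bmeas g ->
    (forall th, 0 <= f th) -> (forall th, 0 <= g th <= 1) -> Ex (fun th => f th * g th) <= Ex f.
  move=> bf bg f0 g01; apply: le_Ex; [by auto with bmeas..|] => th.
  by rewrite ler_piMr//; have /andP[] := g01 th.
(* The first mean is at most [m * p t] and at most [m * q t], so it is zero as soon as [p t] or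
   [q t] is. *)
have [pz|pn0] := eqVneq (p t) 0.
  apply: le_trans bound0; rewrite pz mulr0 mul0r subr0.
  apply: (le_trans (X_le _ _ _ _ _ _)); [by auto with bmeas..|by move=> th; rewrite mulr_ge0|by move=> th; exact: P01|].
  by rewrite -mp pz mulr0.
have [qz|qn0] := eqVneq (q t) 0.
  apply: le_trans bound0; rewrite qz mulr0 subr0.
  rewrite (_ : Ex _ = Ex (fun th => (L th * P th t) * (x (sel th) t)%:R)); last first.
    by apply: eq_Ex => th; ring.
  apply: (le_trans (X_le _ _ _ _ _ _)); [by auto with bmeas..|by move=> th; rewrite mulr_ge0| |].
    by move=> th; case: x; rewrite ?ler01 ?lexx.
  by rewrite -mq qz mulr0.
have pt0 : 0 < p t by rewrite lt0r pn0 p_ge0.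
have qt0 : 0 < q t by rewrite lt0r qn0 q0.
(* Dividing by [2 * mu = lam / p t] turns [4 * mu ^+ 2 * (m * p t)] into [lam * m], and [kl t] into
   [p t * kl t / lam]. *)
pose mu := lam / (2 * p t).
have key : Ex (fun th => 2 * mu * ((x (sel th) t)%:R * L th * P th t - q t * ((x (sel th) t)%:R * L th))) <=
   Ex (fun th => 4 * mu ^+ 2 * ((x (sel th) t)%:R * L th) +
     L th * (P th t * ln (P th t) - P th t * ln (q t) - P th t + q t)).
  apply: le_Ex; [by auto 10 with bmeas..|] => th.
  have qb : 0 < q t <= 1 by rewrite qt0.
  have := @sub_le_kl R (P th t) (q t) mu (P01 th t) qb.
  (* The case [mu = 0] makes the entropy integrand nonnegative, which settles the parameters for
     which [sel th] is incompatible with [t]. *)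
  have := @sub_le_kl R (P th t) (q t) 0 (P01 th t) qb.
  rewrite mulr0 mul0r expr0n mulr0 add0r.
  move: (_ + q t) => k k0 kle.
  case: (x (sel th) t); last by rewrite !mul0r !mulr0 subrr mulr0 add0r mulr_ge0.
  by rewrite !mul1r; have := ler_wpM2l (L0 th) kle; lra.
move: key; rewrite ExD ?ExZ ?ExB ?ExZ; [|by auto 10 with bmeas..].
rewrite ExkE -mp => key.
have lamp : 0 < lam / p t by rewrite divr_gt0.
rewrite -(ler_pM2l lamp).
have e1 : 2 * mu = lam / p t by rewrite /mu; field.
have e2 : 4 * mu ^+ 2 * (m * p t) = lam / p t * (lam * m) by rewrite /mu; field.
rewrite [X in _ <= X]mulrDr -e2 (_ : lam / p t * (p t * kl t / lam) = kl t); last first.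
  by field; rewrite pn0 gt_eqF.
rewrite -e1; apply: le_trans key; rewrite le_eqVlt; apply/orP; left; apply/eqP; ring.
Qed.

(** The sampled policy is independent of theta given [D], so it contributes [m * p t * q t] where
    the optimal one contributes the mean of the product. The regret is thus the sum over [t] of
    [rho t] times the covariance bounded in [cross]. *)
Lemma regret_step lam : 0 < lam ->
  Ex (fun th => L th * \sum_pi psamp D pi * preg th pi) <=
  B * (lam * #|Tr|%:R * m +
    (\sum_(e : E) psamp D e.1 * infogain (e :: D) - infogain D) / lam).
Proof.
move=> lam0; rewrite infogain_step.
have -> : Ex (fun th => L th * \sum_pi psamp D pi * preg th pi) =
   \sum_t rho t * (Ex (fun th => (x (sel th) t)%:R * L th * P th t) - m * p t * q t).
  transitivity (\sum_t Ex (fun th => rho t * ((x (sel th) t)%:R * L th * P th t - p t * (L th * P th t)))).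
    rewrite -Ex_sum; last by auto 10 with bmeas.
    apply: eq_Ex => th.
    rewrite /preg.
    under eq_bigr do rewrite mulrBr.
    rewrite sumrB -mulr_suml sum_psamp// mul1r mulrBr.
    under [X in _ - L th * X = _]eq_bigr do rewrite /pvalue mulr_sumr.
    rewrite exchange_big/= /pvalue !mulr_sumr -sumrB; apply: eq_bigr => t _.
    rewrite /p.
    have -> : \sum_i psamp D i * ((x i t)%:R * P th t * rho t) = (\sum_i psamp D i * (x i t)%:R) * (P th t * rho t).
      by rewrite mulr_suml; apply: eq_bigr => i _; ring.
    by ring.
  apply: eq_bigr => t _; rewrite ExZ ?ExB ?ExZ; [|by auto 10 with bmeas..].
  by rewrite -mq; ring.
have -> : lam * #|Tr|%:R * m + (\sum_t p t * kl t) / lam = \sum_t (lam * m + p t * kl t / lam).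
  rewrite big_split/= sumr_const -mulr_suml; congr (_ + _).
  by rewrite -[_ *+ _]mulr_natr; ring.
rewrite mulr_sumr; apply: ler_sum => t _; have /andP[r0 rB] := rhoB t.
apply: le_trans (ler_wpM2l r0 (cross t lam0)) _; apply: ler_wpM2r => //.
by rewrite addr_ge0// ?divr_ge0 ?mulr_ge0 ?kl_ge0 ?p_ge0 ?ltW.
Qed.

End Step.

(** * Summation over histories and episodes *)

Lemma infogain0 D : evid D = 0 -> infogain D = 0.
Proof.
by move=> m0; rewrite /infogain Ex0_mul// m0 mul0r subr0.
Qed.

(** Trajectories have total mass one under each policy, but on a history with [evid D = 0] the
    weights [psamp D] sum to zero, whence an inequality. *)
Lemma sum_psamp_lik (p : Tr -> R) D : (forall t, 0 <= p t) ->
  (forall pi, \sum_t (x pi t)%:R * p t = 1) ->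
  \sum_(e : E) psamp D e.1 * lik p (e :: D) <= lik p D.
Proof.
move=> p0 xp1.
have -> : \sum_(e : E) psamp D e.1 * lik p (e :: D) =
    \sum_pi \sum_t psamp D pi * lik p ((pi, t) :: D).
  by rewrite pair_bigA; apply: eq_bigr => -[].
rewrite (eq_bigr (fun pi => psamp D pi * lik p D)).
  by rewrite -mulr_suml ler_piMl ?lik_ge0// sum_psamp_le1.
by move=> pi _; rewrite -mulr_sumr /= -mulr_sumr xp1 mulr1.
Qed.

(** The trajectories may follow any fixed [p], in particular a covering model, while the policies
    are still drawn from the posterior of [nu]. *)
Lemma hsum_pweight_lik (p : Tr -> R) k : (forall t, 0 <= p t) ->
  (forall pi, \sum_t (x pi t)%:R * p t = 1) ->
  hsum k (fun D => pweight D * lik p D) <= 1.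
Proof.
move=> p0 xp1; elim: k => [|k IH]; first by rewrite /= mulr1.
apply: le_trans IH; apply: (@le_hsum R E k) => D _.
under eq_bigr do rewrite /= -mulrA.
by rewrite -mulr_sumr ler_wpM2l ?pweight_ge0//; exact: sum_psamp_lik.
Qed.

Lemma hsum_pweight_evid k : hsum k (fun D => pweight D * evid D) <= 1.
Proof.
rewrite -[leRHS](Ex_cst nu).
under eq_hsum do rewrite -ExZ//.
rewrite -(Ex_hsum nu k (F := fun D th => pweight D * lik (P th) D)); last by auto with bmeas.
apply: le_Ex; [|by auto with bmeas|by move=> th; exact: hsum_pweight_lik].
by apply: (@bmeas_hsum R E _ _ k (fun D th => pweight D * lik (P th) D)); auto with bmeas.
Qed.

Lemma regret_step_le D lam : 0 < lam ->
  Ex (fun th => lik (P th) D * \sum_pi psamp D pi * preg th pi) <=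
  B * (lam * #|Tr|%:R * evid D +
    (\sum_(e : E) psamp D e.1 * infogain (e :: D) - infogain D) / lam).
Proof.
move=> lam0; have [m0|mn0] := eqVneq (evid D) 0; last first.
  by apply: regret_step => //; rewrite lt0r mn0 evid_ge0.
rewrite m0 infogain0// subr0 mulr0 add0r big1 => [|e _]; last by rewrite psamp0// mul0r.
rewrite mul0r mulr0 -[leRHS](Ex_cst nu 0) (@eq_Ex _ _ _ nu _ (fun=> 0))// => th.
by rewrite big1 ?mulr0// => pi _; rewrite psamp0// mul0r.
Qed.

Hypothesis B0 : 0 <= B.

Definition cumreg K th := hsum K (fun D =>
  pweight D * lik (P th) D * \sum_(e <- D) preg th e.1).

Let bpreg pi : bmeas (preg^~ pi).
Proof.
have bval pi' : bmeas (fun th => pvalue (P th) pi') by rewrite /pvalue; auto with bmeas.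
by apply: bmeasB => //; exact: (bmeas_sel (F := fun pi' th => pvalue (P th) pi')).
Qed.

#[local] Hint Resolve bpreg : bmeas.

Lemma bmeas_cumreg K : bmeas (cumreg K).
Proof.
apply: (bmeas_hsum K (F := fun D th => pweight D * lik (P th) D * \sum_(e <- D) preg th e.1)).
by move=> D; auto with bmeas.
Qed.

(** The regret splits into that of the past and that of the new episode. The past regret is
    nonnegative by [sel_opt], so the mass lost on null histories can only lower it. *)
Lemma cumregS K th : cumreg K.+1 th <=
  cumreg K th + hsum K (fun D => pweight D * (lik (P th) D * \sum_pi psamp D pi * preg th pi)).
Proof.
rewrite -hsumD; apply: (@le_hsum R E K) => D _.
set S := \sum_(e <- D) _; have S0 : 0 <= S by apply: sumr_ge0 => e _.
set w := pweight D.
have -> : \sum_e pweight (e :: D) * lik (P th) (e :: D) * \sum_(e0 <- e :: D) preg th e0.1 =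
   w * S * (\sum_(e : E) psamp D e.1 * lik (P th) (e :: D)) +
   w * (lik (P th) D * \sum_pi psamp D pi * preg th pi).
  transitivity (\sum_(e : E) (w * S * (psamp D e.1 * lik (P th) (e :: D)) +
      w * (psamp D e.1 * preg th e.1 * lik (P th) (e :: D)))).
    by apply: eq_bigr => e _; rewrite big_cons /= -/S -/w; ring.
  rewrite big_split/= -!mulr_sumr; congr (_ + w * _).
  transitivity (\sum_pi \sum_t psamp D pi * preg th pi * lik (P th) ((pi, t) :: D)).
    by rewrite pair_bigA; apply: eq_bigr => -[].
  rewrite mulr_sumr; apply: eq_bigr => pi _.
  by rewrite -mulr_sumr /= -mulr_sumr xP1; ring.
rewrite lerD2r (_ : w * _ * S = w * S * lik (P th) D); last by ring.
by rewrite ler_wpM2l ?mulr_ge0 ?pweight_ge0// sum_psamp_lik.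
Qed.

(** The differences of [infogain] telescope from the empty history, whose gain is zero. Each episode
    adds at most [B * lam * #|Tr|%:R] besides, since the weights [pweight D * evid D] sum to at most
    one. *)
Lemma cumreg_infogain K lam : 0 < lam ->
  Ex (cumreg K) <= B * (lam * #|Tr|%:R * K%:R +
    hsum K (fun D => pweight D * infogain D) / lam).
Proof.
move=> lam0; elim: K => [|K IH].
  rewrite /= mulr0 add0r mul1r (@eq_Ex _ _ _ nu _ (fun=> 0)); last first.
    by move=> th; rewrite /cumreg /= big_nil mulr0.
  rewrite Ex_cst /infogain /evid /= !Ex_cst ln1 mulr0 subrr mul0r mulr0//.
pose G D th := pweight D * (lik (P th) D * \sum_pi psamp D pi * preg th pi).
have bG D : bmeas (G D) by rewrite /G; auto 10 with bmeas.
have : Ex (cumreg K.+1) <= Ex (cumreg K) + hsum K (fun D => Ex (G D)).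
  rewrite -Ex_hsum// -ExD; [|exact: bmeas_cumreg|exact: bmeas_hsum].
  apply: le_Ex; [exact: bmeas_cumreg| |exact: cumregS].
  by apply: bmeasD; [exact: bmeas_cumreg|exact: bmeas_hsum].
move/le_trans; apply; apply: le_trans (lerD IH (lexx _)) _.
have : hsum K (fun D => Ex (G D)) <= hsum K (fun D =>
    B * lam * #|Tr|%:R * (pweight D * evid D) + (B / lam *
    (\sum_(e : E) pweight (e :: D) * infogain (e :: D)) + (- (B / lam)) * (pweight D * infogain D))).
  apply: le_hsum => D _; rewrite ExZ; last by auto 10 with bmeas.
  apply: le_trans (ler_wpM2l (pweight_ge0 D) (regret_step_le D lam0)) _.
  under [X in _ <= _ + (_ * X + _)]eq_bigr do rewrite /= -mulrA.
  rewrite -mulr_sumr le_eqVlt; apply/orP; left; apply/eqP; ring.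
rewrite !hsumD !hsumZ.
rewrite -[hsum K.+1 _]/(hsum K (fun D => \sum_(e : E) pweight (e :: D) * infogain (e :: D))).
have c0 : 0 <= B * lam * #|Tr|%:R by rewrite !mulr_ge0// ltW.
have := ler_wpM2l c0 (hsum_pweight_evid K).
move: (hsum K (fun D => pweight D * evid D)) => m.
move: (hsum K (fun D => pweight D * infogain D)) => X.
move: (hsum K (fun D => \sum_e _)) => Y.
move: (hsum K (fun D => Ex (G D))) => Z.
move: #|Tr|%:R => N; rewrite -natr1; move: K%:R => k h1 h2.
apply: le_trans (lerD (lexx _) h2) _.
rewrite addrCA; apply: le_trans (lerD h1 (lexx _)) _.
rewrite le_eqVlt; apply/orP; left; apply/eqP; ring.
Qed.

(** * Bounding the total information by a finite cover *)

Section Cover.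
Variables (I : finType) (Q : I -> Tr -> R) (a : R).
Hypothesis Q0 : forall i t, 0 <= Q i t.
Hypothesis xQ1 : forall i pi, \sum_t (x pi t)%:R * Q i t = 1.
Hypothesis cover : forall th, exists i, forall t, P th t <= expR a * Q i t.

(** Each episode costs a factor [expR a]; summing over all covering models makes the bound the same
    for every [th]. *)
Lemma lik_cover th D :
  lik (P th) D <= expR (a * (size D)%:R) * \sum_i lik (Q i) D.
Proof.
have [i Pi_le] := cover th.
apply: (@le_trans _ _ (expR (a * (size D)%:R) * lik (Q i) D)); last first.
  rewrite ler_wpM2l ?expR_ge0// (bigD1 i)//= lerDl sumr_ge0// => j _.
  exact: lik_ge0.
elim: D => /= [|e D IH]; first by rewrite mulr0 expR0 mul1r.
rewrite -natr1 mulrDr mulr1 expRD mulrACA.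
apply: ler_pM => //; first by rewrite mulr_ge0.
by rewrite mulrCA; case: x; rewrite ?mul0r ?mul1r.
Qed.

Lemma cover_card_gt0 : 0 < #|I|%:R :> R.
Proof.
have [th _] := probability_inhabited nu.
by rewrite ltr0n; have [i _] := cover th; apply/card_gt0P; exists i.
Qed.

(** Let [Z] be the sum of the covering likelihoods and [N] their number. By [lik_cover] the gain is
    at most [evid D] times [a * size D + ln Z - ln (evid D)], and [ln y <= y - 1] at
    [y = Z / N / evid D] trades [ln Z] for a term linear in [Z], which can be averaged over
    histories. *)
Lemma infogain_le D : infogain D <=
  (a * (size D)%:R + ln #|I|%:R) * evid D + #|I|%:R^-1 * \sum_i lik (Q i) D.
Proof.
have Z0 : 0 <= \sum_i lik (Q i) D by apply: sumr_ge0 => i _; exact: lik_ge0.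
have [m0|mn0] := eqVneq (evid D) 0.
  by rewrite infogain0// m0 mulr0 add0r mulr_ge0.
have m0 : 0 < evid D by rewrite lt0r mn0 evid_ge0.
move: Z0; set Z := \sum_i _ => Z0; set c := a * _.
have Zp : 0 < Z.
  have : evid D <= expR c * Z.
    rewrite -[leRHS](Ex_cst nu); apply: le_Ex; [by auto with bmeas..|].
    by move=> th; exact: lik_cover.
  by move/(lt_le_trans m0); rewrite pmulr_rgt0// expR_gt0.
have N0 := cover_card_gt0.
have LlnL : Ex (fun th => lik (P th) D * ln (lik (P th) D)) <= evid D * (c + ln Z).
  rewrite -ExZr//; apply: le_Ex; [by auto with bmeas..|] => th.
  have := likP0 th D; rewrite le_eqVlt => /predU1P[<-|l0]; first by rewrite !mul0r.
  rewrite ler_wpM2l// -[c]expRK -lnM ?posrE ?expR_gt0// ler_ln ?posrE ?mulr_gt0 ?expR_gt0//.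
  exact: lik_cover.
have lnZ : ln Z - ln (evid D) - ln #|I|%:R <= Z / #|I|%:R / evid D - 1.
  have zp : 0 < Z / #|I|%:R / evid D by rewrite !divr_gt0.
  have := @le_ln1Dx R (Z / #|I|%:R / evid D - 1).
  rewrite [1 + _]addrC subrK !ln_div ?posrE ?divr_gt0// => h.
  have : - 1 < Z / #|I|%:R / evid D - 1 by lra.
  by move=> /h; lra.
have := ler_wpM2l (ltW m0) lnZ.
rewrite [X in _ <= X](_ : _ = #|I|%:R^-1 * Z - evid D); last by field; rewrite mn0 gt_eqF.
rewrite /infogain; lra.
Qed.

(** The bound of [infogain_le] is linear in [evid] and in each covering likelihood, all of which
    have total weight at most one; the average over the models gives the final 1. *)
Lemma hsum_pweight_infogain K : 0 <= a ->
  hsum K (fun D => pweight D * infogain D) <= a * K%:R + ln #|I|%:R + 1.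
Proof.
move=> a0; have N0 := cover_card_gt0.
have c0 : 0 <= a * K%:R + ln #|I|%:R.
  by rewrite addr_ge0 ?mulr_ge0// ln_ge0// ler1n -(ltr0n R).
apply: (@le_trans _ _ (hsum K (fun D => (a * K%:R + ln #|I|%:R) * (pweight D * evid D) +
    #|I|%:R^-1 * \sum_i pweight D * lik (Q i) D))).
  apply: le_hsum => D sD; apply: le_trans (ler_wpM2l (pweight_ge0 D) (infogain_le D)) _.
  by rewrite sD -mulr_sumr le_eqVlt; apply/orP; left; apply/eqP; ring.
rewrite hsumD !hsumZ hsum_sum; apply: lerD.
  by rewrite ler_piMr// hsum_pweight_evid.
rewrite mulrC ler_pdivrMr// mul1r -sum1_card natr_sum; apply: ler_sum => i _.
exact: hsum_pweight_lik.
Qed.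

Lemma regret_bound K lam : 0 <= a -> 0 < lam ->
  Ex (cumreg K) <= B * (lam * #|Tr|%:R * K%:R + (a * K%:R + ln #|I|%:R + 1) / lam).
Proof.
move=> a0 lam0; apply: le_trans (cumreg_infogain K lam0) _.
apply: (ler_wpM2l B0); rewrite lerD2l; apply: ler_wpM2r; first by rewrite invr_ge0 ltW.
exact: hsum_pweight_infogain.
Qed.

End Cover.

End ThompsonSampling.

(** * The law of a POMDP trajectory *)

Section CausalProduct.
Context {R : realType} {X : finType}.

Definition upd (I : finType) (t : {ffun I -> X}) (h : I) (y : X) : {ffun I -> X} :=
  [ffun j => if j == h then y else t j].

(* The map (t, y) |-> (upd t h y, t h) is an involution. *)
Lemma sum_upd (I : finType) (h : I) (g : {ffun I -> X} -> R) :
  \sum_t \sum_y g (upd t h y) = #|X|%:R * \sum_t g t.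
Proof.
transitivity (\sum_(u : {ffun I -> X} * X) g u.1).
  rewrite pair_bigA (reindex_inj (h := fun u => (upd u.1 h u.2, u.1 h)))/=.
    apply: eq_bigr => -[t y] _ /=; congr g; apply/ffunP => j.
    by rewrite !ffunE; case: eqP => // ->.
  apply: (inv_inj (f := fun u => (upd u.1 h u.2, u.1 h))) => -[t y] /=.
  rewrite ffunE eqxx; congr (_, _); apply/ffunP => j.
  by rewrite !ffunE; case: eqP => // ->.
rewrite -(pair_bigA _ (fun t y => g t))/= mulr_sumr; apply: eq_bigr => t _.
by rewrite sumr_const mulr_natl.
Qed.

(** Coordinates are summed out from the last to the first: the factor at the last step is the only
    one that sees the last coordinate. *)
Lemma sum_causal_prod H (F : 'I_H -> {ffun 'I_H -> X} -> R) :
  (forall (h : 'I_H) (t t' : {ffun 'I_H -> X}), (forall j : 'I_H, (j <= h)%N -> t j = t' j) -> F h t = F h t') ->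
  (forall h t, \sum_y F h (upd t h y) = 1) -> (0 < #|X|)%N ->
  \sum_t \prod_h F h t = 1.
Proof.
move=> Fc F1 X0.
(* All coordinates stay summed over; those from [n] on are free and contribute [#|X| ^ (H - n)],
   which the prefactor completes to [#|X| ^ H]. *)
have main n : (n <= H)%N ->
    #|X|%:R ^+ n * \sum_t \prod_(h : 'I_H | (h < n)%N) F h t = #|X|%:R ^+ H :> R.
  elim: n => [_|n IH nH].
    rewrite expr0 mul1r (eq_bigr (fun=> 1)); last by move=> t _; rewrite big_pred0.
    by rewrite sumr_const card_ffun card_ord -natrX.
  rewrite -(IH (ltnW nH)) exprSr -mulrA -(sum_upd (Ordinal nH)); congr (_ * _).
  apply: eq_bigr => t _.
  transitivity (\sum_y F (Ordinal nH) (upd t (Ordinal nH) y) *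
                       \prod_(h : 'I_H | (h < n)%N) F h t); last first.
    by rewrite -mulr_suml F1 mul1r.
  apply: eq_bigr => y _; rewrite (bigD1 (Ordinal nH))//=; congr (_ * _).
  apply: eq_big => h; first by rewrite -val_eqE /= ltnS ltn_neqAle andbC.
  rewrite -val_eqE /= => hn; apply: Fc => j jh; rewrite ffunE -val_eqE /=.
  by case: eqP => // jn; move: hn jh; rewrite jn ltnS => /andP[]; lia.
have XH : #|X|%:R ^+ H != 0 :> R by rewrite expf_neq0// pnatr_eq0 -lt0n.
apply: (mulfI XH); rewrite mulr1 -[RHS](main H (leqnn H)); congr (_ * _).
by apply: eq_bigr => t _; apply: eq_bigl => h; rewrite ltn_ord.
Qed.

End CausalProduct.

Lemma prod_nat_of_bool (R : realType) (I : finType) (b : pred I) :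
  \prod_i (b i)%:R = [forall i, b i]%:R :> R.
Proof.
case: (boolP [forall i, b i]) => [/forallP bT|/forallPn[i /negbTE bi]].
  by rewrite big1// => i _; rewrite bT.
by rewrite (bigD1 i)//= bi mul0r.
Qed.

Definition prv H (h : 'I_H) : 'I_H := insubd h h.-1.

Lemma val_prv H (h : 'I_H) : prv h = h.-1 :> nat.
Proof. by rewrite val_insubd (leq_ltn_trans (leq_pred h) (ltn_ord h)). Qed.

(** The transition out of a step is charged to the following step, so that every factor depends on
    the present and the past only. *)
Lemma prod_nxt_prv (R : realType) H (T : 'I_H -> 'I_H -> R) :
  \prod_(h < H) (if (h.+1 < H)%N then T h (nxt h) else 1) =
  \prod_(h < H) (if (h == 0 :> nat) then 1 else T (prv h) h).
Proof.
case: H T => [|H] T; first by rewrite !big_ord0.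
rewrite big_ord_recr big_ord_recl /= ltnn mulr1 mul1r; apply: eq_bigr => i _.
rewrite ltnS ltn_ord; congr T; apply: val_inj.
  by rewrite /= val_prv.
by rewrite /= val_insubd /= ltnS ltn_ord.
Qed.

Lemma is_distr_inhabited (R : realType) (T : finType) (p : T -> R) : is_distr p -> (0 < #|T|)%N.
Proof.
move=> [_ p1]; rewrite lt0n; apply/eqP => T0; move: p1.
rewrite big1 => [/esym/eqP|x _]; first by rewrite oner_eq0.
by have := fintype0 x; rewrite T0 => /(_ erefl).
Qed.

Section TrajectoryLaw.
Context {R : realType} {St Ac Ob : finType} {H : nat}.
Implicit Types (m : model R St Ac Ob H) (pi : policy Ac Ob H) (t : traj Ac Ob H).

Definition agrees pi t := [forall h, pol_act pi h t (t h).1 == (t h).2].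

Lemma pol_probE pi t : pol_prob R pi t = (agrees pi t)%:R.
Proof. exact: (prod_nat_of_bool _ (fun h => pol_act pi h t (t h).1 == (t h).2)). Qed.

Lemma pol_act_causal pi (h : 'I_H) t t' o :
  (forall j : 'I_H, (j < h)%N -> t j = t' j) -> pol_act pi h t o = pol_act pi h t' o.
Proof.
move=> tt'; rewrite /pol_act; case: pi => f /= /forallP/(_ h)/forallP/(_ t)/forallP/(_ t').
move=> /forallP/(_ o)/implyP/(_ _)/eqP; apply.
by apply/forallP => j; apply/implyP => jh; rewrite tt'.
Qed.

(** Observations, actions and states are merged into one sequence over [X], whose weight is a causal
    product in the sense of [sum_causal_prod]. *)
Lemma sum_Prpi m pi : (0 < H)%N -> (0 < #|Ac|)%N -> valid_model m ->
  \sum_t (agrees pi t)%:R * Prminus m t = 1.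
Proof.
move=> H0 Ac0 [b1d [Td Zd]].
pose X := ((Ob * Ac) * St)%type.
pose tr (u : {ffun 'I_H -> X}) : traj Ac Ob H := [ffun h => (u h).1].
pose entry (h : 'I_H) (u : {ffun 'I_H -> X}) s := if h == 0 :> nat then b1 m s
  else Tk m (prv h) (u (prv h)).2 (u (prv h)).1.2 s.
pose F (h : 'I_H) (u : {ffun 'I_H -> X}) : R :=
  (pol_act pi h (tr u) (u h).1.1 == (u h).1.2)%:R * entry h u (u h).2 * Zk m h (u h).2 (u h).1.1.
transitivity (\sum_(u : {ffun 'I_H -> X}) \prod_h F h u).
  rewrite /Prminus; under eq_bigr do rewrite mulr_sumr.
  rewrite pair_bigA /= (reindex (fun u : {ffun 'I_H -> X} =>
    (tr u, [ffun h => (u h).2] : {ffun 'I_H -> St}))) /=; last first.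
    exists (fun v : traj Ac Ob H * {ffun 'I_H -> St} => [ffun h => (v.1 h, v.2 h)] : {ffun 'I_H -> X}) => [u _|[v w] _].
      by apply/ffunP => h; rewrite !ffunE -surjective_pairing.
    by congr pair; apply/ffunP => h; rewrite !ffunE.
  apply: eq_bigr => u _; rewrite -pol_probE /pol_prob.
  pose G (h : 'I_H) := (if h == 0 :> nat then b1 m (u h).2 else 1) * Zk m h (u h).2 (u h).1.1.
  transitivity (\prod_h (pol_act pi h (tr u) (u h).1.1 == (u h).1.2)%:R * (\prod_h G h *
      \prod_(h < H) (if (h.+1 < H)%N then Tk m h (u h).2 (u h).1.2 (u (nxt h)).2 else 1))).
    rewrite -!big_split/=; apply: eq_bigr => h _; congr (_ * _); rewrite ?ffunE//.
  rewrite (prod_nxt_prv (fun h h' => Tk m h (u h).2 (u h).1.2 (u h').2)) -!big_split/=.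
  apply: eq_bigr => h _; rewrite /F /entry /G.
  by case: (h == 0 :> nat); ring.
apply: sum_causal_prod.
- move=> h u u' uu'; rewrite /F (uu' h)//.
  have uprv : entry h u =1 entry h u'.
    by move=> s; rewrite /entry uu'// val_prv leq_pred.
  rewrite uprv; congr ((_ == _)%:R * _ * _); apply: pol_act_causal => j jh.
  by rewrite !ffunE uu'// ltnW.
- move=> h u.
  have entry1 : \sum_s entry h u s = 1.
    rewrite /entry; case: eqP => [_|/eqP h0]; first exact: b1d.2.
    by have [|_ ->] := Td (prv h) (u (prv h)).2 (u (prv h)).1.2; rewrite ?val_prv ?prednK ?lt0n.
  (* The coordinate at [h] is summed in reverse causal order: action, then observation, then
     state. *)
  transitivity (\sum_s entry h u s * \sum_o Zk m h s o *
      \sum_a (pol_act pi h (tr u) o == a)%:R).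
    transitivity (\sum_s \sum_o \sum_a F h (upd u h (o, a, s))).
      rewrite (eq_bigr (fun y => F h (upd u h (y.1.1, y.1.2, y.2)))); last by case=> -[b a] s.
      rewrite -(pair_bigA _ (fun y s => F h (upd u h (y.1, y.2, s))))/= exchange_big/=.
      apply: eq_bigr => s _.
      by rewrite -(pair_bigA _ (fun o a => F h (upd u h (o, a, s)))).
    apply: eq_bigr => s _; rewrite mulr_sumr; apply: eq_bigr => o _.
    rewrite !mulr_sumr; apply: eq_bigr => a _; rewrite /F ffunE eqxx/=.
    have -> : entry h (upd u h (o, a, s)) s = entry h u s.
      rewrite /entry; case: eqP => // /eqP h0; rewrite ffunE ifN//.
      by rewrite -val_eqE /= val_prv neq_ltn prednK ?lt0n// leqnn.
    rewrite (pol_act_causal pi (t' := tr u)); first by ring.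
    by move=> j jh; rewrite !ffunE ifN// -val_eqE /= neq_ltn jh.
  rewrite -[RHS]entry1; apply: eq_bigr => s _.
  rewrite (eq_bigr (fun o => Zk m h s o)); first by rewrite (Zd h s).2 mulr1.
  move=> o _; rewrite (bigD1 (pol_act pi h (tr u) o))//= eqxx big1 ?addr0 ?mulr1// => a.
  by rewrite eq_sym => /negbTE ->.
- have [s _] := card_gt0P (is_distr_inhabited b1d).
  by rewrite !card_prod !muln_gt0 Ac0 (is_distr_inhabited b1d) (is_distr_inhabited (Zd (Ordinal H0) s)).
Qed.

Lemma Prminus_ge0 m t : valid_model m -> 0 <= Prminus m t.
Proof.
move=> [[b0 _] [Td Zd]]; apply: sumr_ge0 => s _; apply: prodr_ge0 => h _.
rewrite !mulr_ge0//; [by case: ifP|by have [] := Zd h (s h)|].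
by case: ifP => // hH; have [] := Td h (s h) (t h).2 hH.
Qed.

Lemma open_loop_nonanticipating t :
  nonanticipating [ffun u : 'I_H * traj Ac Ob H * Ob => (t u.1.1).2].
Proof.
apply/forallP => h; apply/forallP => t1; apply/forallP => t2; apply/forallP => o.
by apply/implyP => _; rewrite !ffunE.
Qed.

(* Some policy follows t with certainty, so Prminus m t is one of the terms of sum_Prpi. *)
Lemma Prminus_le1 m t : (0 < H)%N -> (0 < #|Ac|)%N -> valid_model m -> Prminus m t <= 1.
Proof.
move=> H0 Ac0 vm; pose pi : policy Ac Ob H := Sub _ (open_loop_nonanticipating t).
rewrite -(sum_Prpi pi H0 Ac0 vm) (bigD1 t)//= (_ : agrees pi t).
  by rewrite mul1r lerDl sumr_ge0// => t' _; rewrite mulr_ge0 ?Prminus_ge0.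
by apply/forallP => h; rewrite /pol_act /= ffunE.
Qed.

End TrajectoryLaw.

(** * PS4POMDPs as posterior sampling *)

(** Translates a product over time, each factor depending on the episodes before it, into a
    recursion on the reversed history. *)
Lemma big_rcons_prefix (R : realType) (T : Type) (x0 : T) (w : seq T -> T -> R)
    (G : seq T -> R) (s : seq T) :
  G [::] = 1 -> (forall e D, G (e :: D) = G D * w D e) ->
  \prod_(k < size s) w (rev (take k s)) (nth x0 s k) = G (rev s).
Proof.
move=> G0 GS; elim/last_ind: s => [|s e IH]; first by rewrite big_ord0 G0.
rewrite rev_rcons GS -IH size_rcons big_ord_recr /= nth_rcons ltnn eqxx.
rewrite -cats1 take_size_cat//; congr (_ * _); apply: eq_bigr => i _.
by rewrite takel_cat ?nth_cat ?ltn_ord// ltnW.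
Qed.

Section Link.
Context {R : realType} {St Ac Ob : finType} {H : nat}.
Context {d : measure_display} {Theta : measurableType d}.
Variables (nu : probability Theta R) (M : Theta -> model R St Ac Ob H).
Variables (planner : Theta -> policy Ac Ob H) (r : 'I_H -> Ob -> Ac -> R).
Hypothesis validM : forall th, valid_model (M th).
Hypothesis measM : measurable_param M.
Hypothesis r01 : forall h o a, 0 <= r h o a <= 1.
Hypothesis planner_opt : exact_planner M planner r.
Hypothesis H0 : (0 < H)%N.
Hypothesis Ac0 : (0 < #|Ac|)%N.

Local Notation Pm := (fun th => Prminus (M th)).
Local Notation x := (@agrees Ac Ob H).
Let rho (t : traj Ac Ob H) := \sum_(h : 'I_H) r h (t h).1 (t h).2.
Local Notation episode := (episode Ac Ob H).

Lemma data_take K (hist : {ffun 'I_K -> episode}) k :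
  data hist k = take k [seq hist j | j <- enum 'I_K].
Proof.
rewrite /data -map_take; congr map.
apply: (inj_map val_inj); rewrite map_take val_enum_ord.
rewrite -(filter_map val (fun j => (j < k)%N)) val_enum_ord.
have [kK|Kk] := leqP k K; last first.
  rewrite take_oversize ?size_iota ?(ltnW Kk)//; apply/all_filterP/allP => j.
  by rewrite mem_iota add0n => /andP[_ jK]; exact: ltn_trans jK Kk.
by rewrite (filter_iota_ltn 0 kK) take_iota (minn_idPl kK).
Qed.

Lemma prod_data K (hist : {ffun 'I_K -> episode}) (w : seq episode -> episode -> R) G :
  G [::] = 1 -> (forall e D, G (e :: D) = G D * w D e) ->
  \prod_(k < K) w (rev (data hist k)) (hist k) = G (rev [seq hist j | j <- enum 'I_K]).
Proof.
(* [nth] needs a default episode, and [hist ord0] provides one when [K] is positive. *)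
case: K hist => [|K] hist G0 GS; first by rewrite big_ord0 (size0nil (size_enum_ord 0)).
rewrite -(big_rcons_prefix (hist ord0) _ G0 GS) size_map size_enum_ord.
apply: eq_bigr => k _; rewrite data_take (nth_map ord0) ?size_enum_ord//.
by rewrite nth_ord_enum.
Qed.

Lemma mPm t : measurable_fun setT (fun th => Pm th t).
Proof.
have [mb [mT mZ]] := measM; apply: measurable_sum => s; apply: measurable_prod => h _.
apply: measurable_funM; last by case: (h.+1 < H)%N.
by apply: measurable_funM => //; case: (h == 0 :> nat).
Qed.

Lemma mplanner pi : measurable_fun setT (fun th => (planner th == pi)%:R : R).
Proof.
have [mpl _] := planner_opt.
rewrite (_ : (fun th => _) = \1_(planner @^-1` [set pi])); first exact: measurable_indic.
apply/funext => th; rewrite indicE; congr (_%:R); congr nat_of_bool.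
by apply/eqP/idP => [<-|]; rewrite ?inE//= => ->.
Qed.

Lemma Pm01 th t : 0 <= Pm th t <= 1.
Proof. by rewrite Prminus_ge0//= Prminus_le1. Qed.

Let bPm t : bmeas (Pm ^~ t).
Proof. by apply: bmeas_unit => [|th]; [exact: mPm|exact: Pm01]. Qed.

Let bplanner pi : bmeas (fun th => (planner th == pi)%:R : R).
Proof.
by apply: bmeas_unit => [|th]; [exact: mplanner|case: (_ == _); rewrite ?ler01 ?lexx].
Qed.

Let blikPm (D : seq episode) : bmeas (fun th => lik x (Pm th) D).
Proof. by elim: D => /= [|e D IH]; auto with bmeas. Qed.

Lemma likP_ge0 th (D : seq episode) : 0 <= lik x (Pm th) D.
Proof. by apply: lik_ge0 => t; have /andP[] := Pm01 th t. Qed.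

(** The normalizers of successive Bayes updates are ratios of consecutive values of [evid], so their
    product telescopes. *)
Lemma post_dens_revE (D : seq episode) th :
  post_dens_rev nu M D th = lik x (Pm th) D / evid nu x Pm D.
Proof.
elim: D th => /= [|e D IH] th; first by rewrite /evid /= Ex_cst invr1 mulr1.
rewrite -[fine _]/(Ex nu (fun th' => post_dens_rev nu M D th' * Prpi (M th') e.1 e.2)).
have -> : Ex nu (fun th' => post_dens_rev nu M D th' * Prpi (M th') e.1 e.2) =
    evid nu x Pm (e :: D) / evid nu x Pm D.
  rewrite /evid -ExZr /=; last by auto 10 with bmeas.
  by apply: eq_Ex => th'; rewrite IH /Prpi pol_probE; ring.
rewrite IH /Prpi pol_probE invf_div.
(* If [evid D] is zero, so is the evidence of the longer history, and both sides vanish because the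
   inverse of 0 is 0. *)
have [m0|mn0] := eqVneq (evid nu x Pm D) 0; last first.
  by rewrite /=; move: (evid nu x Pm (e :: D))^-1 => z; field.
rewrite m0 invr0 !mulr0 !mul0r.
suff -> : evid nu x Pm (e :: D) = 0 by rewrite invr0 mulr0.
by rewrite /evid /= Ex0_mul//; [auto 10 with bmeas..|move=> th'; exact: likP_ge0].
Qed.

Lemma ps_policy_probE K (hist : {ffun 'I_K -> episode}) k pi :
  ps_policy_prob nu M planner hist k pi = psamp nu x Pm planner (rev (data hist k)) pi.
Proof.
rewrite /ps_policy_prob /psamp -ExZr; last by auto 10 with bmeas.
rewrite integral_mkcond /Ex; congr fine; apply: eq_integral => th _.
rewrite patchE /posterior_dens post_dens_revE.
have [/eqP pe|pn] := boolP (planner th == pi); first by rewrite mem_set// mul1r.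
by rewrite memNset ?mul0r ?mul0r//= => /eqP; exact/negP.
Qed.

Lemma valueE th pi : value r (M th) pi = pvalue x rho (Pm th) pi.
Proof. by apply: eq_bigr => t _; rewrite /Prpi pol_probE. Qed.

Lemma rho_bound t : 0 <= rho t <= H%:R.
Proof.
rewrite sumr_ge0 => [|h _]; last by have /andP[] := r01 h (t h).1 (t h).2.
rewrite /= -[X in X%:R]card_ord -sum1_card natr_sum; apply: ler_sum => h _.
by have /andP[] := r01 h (t h).1 (t h).2.
Qed.

Lemma optvalueE th : optvalue r (M th) = value r (M th) (planner th).
Proof.
(* The default 0 of the maximum is harmless because values are nonnegative. *)
apply/le_anti; rewrite le_bigmax andbT; apply/bigmax_leP; split=> [|pi _].
  rewrite valueE; apply: sumr_ge0 => t _.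
  by have /andP[? _] := rho_bound t; have /andP[? _] := Pm01 th t; rewrite !mulr_ge0.
by have [_] := planner_opt; apply.
Qed.

Lemma pregE th pi : optvalue r (M th) - value r (M th) pi = preg x Pm planner rho th pi.
Proof. by rewrite optvalueE !valueE. Qed.

(** The law of a history is regrouped: the policy draws form [pweight] and the trajectory
    probabilities form [lik]. *)
Lemma BReg_PSE K : BReg_PS nu M planner r K = (Ex nu (cumreg nu x Pm planner rho K))%:E.
Proof.
rewrite -ExE; last first.
  by apply: bmeas_cumreg; [exact: Pm01|exact: mPm|exact: mplanner].
apply: eq_integral => th _; congr EFin; rewrite /cumreg -hsum_ffun.
apply: eq_bigr => hist _.
pose G D := pweight nu x Pm planner D * lik x (Pm th) D.
pose w D (e : episode) := psamp nu x Pm planner D e.1 * Prpi (M th) e.1 e.2.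
congr (_ * _).
  rewrite -[RHS]/(G _) -(@prod_data K hist w G); last 2 first.
  - by rewrite /G /= mulr1.
  - by move=> e D; rewrite /G /w /= /Prpi pol_probE; ring.
  by apply: eq_bigr => k _; rewrite ps_policy_probE.
rewrite (perm_big [seq hist j | j <- enum (ordinal K)]); last by rewrite perm_rev.
rewrite big_map big_enum/=; apply: eq_bigr => k _; exact: pregE.
Qed.

End Link.

(** * A finite cover of the models *)

Section Grid.
Context {R : realType} {X : finType} {n : nat}.
Implicit Type u : {ffun X -> 'I_n.+1}.

(* Adding 1 to every count keeps the total positive whatever u is. *)
Definition gridp u (y : X) : R := (u y).+1%:R / \sum_z (u z).+1%:R.

Lemma gridp_sum_gt0 u : (0 < #|X|)%N -> 0 < \sum_z (u z).+1%:R :> R.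
Proof.
by case/card_gt0P => y _; rewrite (bigD1 y)//= ltr_pwDl ?ltr0Sn// sumr_ge0.
Qed.

Lemma gridp_distr u : (0 < #|X|)%N -> is_distr (gridp u).
Proof.
move=> X0; have s0 := gridp_sum_gt0 u X0; split=> [y|].
  by rewrite divr_ge0// ltW.
by rewrite -mulr_suml divff// gt_eqF.
Qed.

(** The counts are the integer parts of [n * p y]. Adding 1 to each puts it above [n * p y], while
    the total is at most [n + #|X|]. *)
Lemma gridp_cover (p : X -> R) : (0 < n)%N -> is_distr p ->
  exists u, forall y, p y <= (1 + #|X|%:R / n%:R) * gridp u y.
Proof.
move=> n0 pd; have [p0 p1] := pd; have nR0 : 0 < n%:R :> R by rewrite ltr0n.
pose f y := Num.truncn (n%:R * p y).
have fle y : (f y)%:R <= n%:R * p y by rewrite truncn_le mulr_ge0.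
have fgt y : n%:R * p y <= (f y).+1%:R by rewrite ltW// truncnS_gt.
have py1 y : p y <= 1 by rewrite -p1 (bigD1 y)//= lerDl sumr_ge0.
have fn y : (f y < n.+1)%N.
  by rewrite ltnS -(ler_nat R) (le_trans (fle y))// ler_piMr.
exists [ffun y => Ordinal (fn y)] => y; rewrite /gridp ffunE /=.
have X0 := is_distr_inhabited pd.
have := gridp_sum_gt0 [ffun y => Ordinal (fn y)] X0.
set s := \sum_z _ => s0.
have sle : s <= n%:R + #|X|%:R.
  rewrite /s (eq_bigr (fun z => (f z)%:R + 1)); last by move=> z _; rewrite ffunE /= natr1.
  rewrite big_split/= sumr_const; apply: lerD => //.
  by rewrite -[leRHS]mulr1 -[X in _ <= _ * X]p1 mulr_sumr; apply: ler_sum.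
rewrite -(ler_pM2l nR0) (le_trans (fgt y))//.
have -> : n%:R * ((1 + #|X|%:R / n%:R) * ((f y).+1%:R / s)) =
    (f y).+1%:R * ((n%:R + #|X|%:R) / s) :> R by field; rewrite !gt_eqF.
by rewrite ler_peMr// ler_pdivlMr// mul1r.
Qed.

End Grid.

Section ModelCover.
Context {R : realType} {St Ac Ob : finType} {H : nat} (n : nat).

Definition model_grid :=
  ({ffun St -> 'I_n.+1} *
   {ffun 'I_H * St * Ac -> {ffun St -> 'I_n.+1}} *
   {ffun 'I_H * St -> {ffun Ob -> 'I_n.+1}})%type.

Definition grid_model (i : model_grid) : model R St Ac Ob H :=
  Model (gridp i.1.1) (fun h s a => gridp (i.1.2 (h, s, a))) (fun h s => gridp (i.2 (h, s))).

Lemma card_model_grid :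
  #|{: model_grid}| = (n.+1 ^ (#|St| + #|St| * (H * #|St| * #|Ac|) + #|Ob| * (H * #|St|)))%N.
Proof.
by rewrite !card_prod !card_ffun !card_prod !card_ord !expnD !expnM.
Qed.

Lemma grid_model_valid i : (0 < #|St|)%N -> (0 < #|Ob|)%N -> valid_model (grid_model i).
Proof.
by move=> S0 O0; split; [exact: gridp_distr|split=> *; exact: gridp_distr].
Qed.

(** Each of the [H] steps has three factors (initial law, observation, transition), and rounding
    each one costs at most [c]; a factor replaced by 1 is covered since [1 <= c]. *)
Lemma model_cover (m : model R St Ac Ob H) : (0 < n)%N -> valid_model m ->
  exists i, forall t, Prminus m t <=
    expR (3 * H%:R * (#|St| + #|Ob|)%:R / n%:R) * Prminus (grid_model i) t.
Proof.
move=> n0 vm; have [bd [Td Zd]] := vm; have nR0 : 0 < n%:R :> R by rewrite ltr0n.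
have S0 := is_distr_inhabited bd.
pose c : R := expR ((#|St| + #|Ob|)%:R / n%:R).
have c1 : 1 <= c by rewrite -expR0 ler_expR divr_ge0.
have c0 : 0 <= c by exact: le_trans ler01 c1.
have cle (X : finType) (p : X -> R) : is_distr p -> (#|X| <= #|St| + #|Ob|)%N ->
    exists u : {ffun X -> 'I_n.+1}, forall y, p y <= c * gridp u y.
  move=> pd Xle; have [u up] := gridp_cover n0 pd; exists u => y.
  have gd := gridp_distr (R := R) u (is_distr_inhabited pd).
  rewrite (le_trans (up y))// ler_wpM2r ?gd.1// (le_trans (expR_ge1Dx _))//.
  by rewrite ler_expR ler_pM2r ?invr_gt0// ler_nat.
have [ub ubP] := cle _ _ bd (leq_addr _ _).
(* [Tk] is a distribution only when [h.+1 < H]; elsewhere any grid point serves, here [ub]. *)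
have /choice[uT uTP] : forall v : 'I_H * St * Ac, exists u : {ffun St -> 'I_n.+1},
    (v.1.1.+1 < H)%N -> forall y, Tk m v.1.1 v.1.2 v.2 y <= c * gridp u y.
  move=> [[h s] a] /=; case: (boolP (h.+1 < H)%N) => [hH|_]; last by exists ub.
  by have [u uP] := cle _ _ (Td h s a hH) (leq_addr _ _); exists u.
have /choice[uZ uZP] : forall v : 'I_H * St, exists u : {ffun Ob -> 'I_n.+1},
    forall y, Zk m v.1 v.2 y <= c * gridp u y.
  by move=> [h s] /=; exact: cle (Zd h s) (leq_addl _ _).
exists (ub, finfun uT, finfun uZ) => t.
rewrite /Prminus mulr_sumr; apply: ler_sum => s _.
have -> : expR (3 * H%:R * (#|St| + #|Ob|)%:R / n%:R) = \prod_(h < H) (c * c * c).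
  rewrite prodr_const card_ord -!expRD -expRM_natl; congr expR.
  by rewrite -mulr_natl; ring.
rewrite -big_split/=; apply: ler_prod => h _; apply/andP; split.
  rewrite !mulr_ge0//; [by case: (h == 0 :> nat); rewrite ?bd.1|exact: (Zd _ _).1|].
  by case: ifP => // hH; exact: (Td _ _ _ hH).1.
rewrite mulrACA [c * c * _]mulrACA !ffunE.
have b0 : 0 <= (if h == 0 :> nat then b1 m (s h) else 1).
  by case: (h == 0 :> nat); rewrite ?bd.1.
have z0 : 0 <= Zk m h (s h) (t h).1 by exact: (Zd _ _).1.
apply: ler_pM; first exact: mulr_ge0.
- by case: ifP => // hH; exact: (Td _ _ _ hH).1.
- apply: ler_pM => //; last exact: (uZP (h, s h)).
  by case: (h == 0 :> nat); [exact: ubP|rewrite mulr1].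
- by case: ifP => hH; [exact: (uTP (h, s h, (t h).2))|rewrite mulr1].
Qed.

End ModelCover.

(** * Degenerate cases, constants and the final bound *)

Lemma expR1_le4 (R : realType) : expR 1 <= 4 :> R.
Proof.
have h : 2^-1 <= expR (- 2^-1) :> R.
  by apply: le_trans (expR_ge1Dx _); lra.
have e0 := expR_gt0 (2^-1 : R).
have e2 : expR 2^-1 <= 2 :> R.
  by move: h; rewrite expRN lef_pV2 ?posrE.
rewrite [X in expR X](_ : _ = 2^-1 + 2^-1); last by field.
by rewrite expRD; nra.
Qed.

Lemma BReg_PS_value0 (R : realType) (St Ac Ob : finType) (H : nat) d
    (Theta : measurableType d) (nu : probability Theta R)
    (M : Theta -> model R St Ac Ob H) r planner K :
  (forall th pi, value r (M th) pi = 0) -> BReg_PS nu M planner r K = 0%E.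
Proof.
move=> v0; rewrite /BReg_PS integral0_eq// => th _; congr EFin.
rewrite big1// => hist _; rewrite [X in _ * X]big1 ?mulr0// => k _.
rewrite v0 subr0 /optvalue; under eq_bigr do rewrite v0.
by elim/big_rec: _ => // pi y _ ->; rewrite maxxx.
Qed.

(** The base is at most [X ^ 4], as 3, [H], [K] and [S + O + 1] are each at most [X]. The exponent
    is [S + H * D], hence at most [2 * H * D]. *)
Lemma ln_card_model_grid_le (R : realType) (S A O H K : nat) (D := (S ^ 2 * A + S * O)%N)
    (X := (3 + S + A + O + H + K)%N) :
  (0 < S)%N -> (0 < A)%N -> (0 < O)%N -> (0 < H)%N -> (0 < K)%N ->
  ln (((3 * H * K * (S + O)).+1 ^ (S + S * (H * S * A) + O * (H * S)))%:R : R)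
    <= 8 * H%:R * D%:R * ln (X%:R).
Proof.
move=> S0 A0 O0 H0 K0.
have X0 : 0 < X%:R :> R by rewrite ltr0n.
have l0 : 0 <= ln (X%:R) :> R by rewrite ln_ge0// ler1n.
have XR : ln ((3 * H * K * (S + O)).+1%:R) <= 4 * ln (X%:R) :> R.
  rewrite mulr_natl -lnXn// ler_ln ?posrE ?ltr0Sn ?exprn_gt0// -natrX ler_nat.
  have HX : (H <= X)%N by rewrite /X; lia.
  have KX : (K <= X)%N by rewrite /X; lia.
  have SX : ((S + O).+1 <= X)%N by rewrite /X; lia.
  have TX : (3 <= X)%N by rewrite /X; lia.
  have : (3 * H * K * (S + O).+1 <= X * X * X * X)%N by rewrite !leq_mul.
  have : (1 <= 3 * H * K)%N by rewrite !muln_gt0 H0 K0.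
  rewrite !expnS expn0 muln1 -!mulnA; nia.
rewrite natrX lnXn ?ltr0Sn// -[_ *+ _]mulr_natr.
have EXP : (S + S * (H * S * A) + O * (H * S) <= 2 * H * D)%N.
  have SA : (S <= H * S * S * A)%N by rewrite -[X in (X <= _)%N]mul1n -!mulnA [(S * A)%N]mulnC; nia.
  rewrite /D; nia.
apply: (@le_trans _ _ (4 * ln X%:R * (2 * H * D)%:R)).
  apply: ler_pM => //; last by rewrite ler_nat.
  by rewrite ln_ge0// ler1n.
by rewrite !natrM le_eqVlt; apply/orP; left; apply/eqP; ring.
Qed.

Theorem theorem1 (R : realType) :
  exists (C : R) (c : nat), 0 < C /\
  forall (St Ac Ob : finType) (H : nat)
         (d : measure_display) (Theta : measurableType d)
         (nu1 : probability Theta R)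
         (M : Theta -> model R St Ac Ob H)
         (r : 'I_H -> Ob -> Ac -> R)
         (planner : Theta -> policy Ac Ob H),
    (forall th, valid_model (M th)) ->
    measurable_param M ->
    (forall h o a, 0 <= r h o a <= 1) ->
    exact_planner M planner r ->
    forall K : nat,
      let S := #|{: St}| in let A := #|{: Ac}| in let O := #|{: Ob}| in
      (BReg_PS nu1 M planner r K <=
       (C * (H%:R ^+ 2) *
        Num.sqrt (((S ^ 2 * A + S * O) * (O * A) ^ H * K)%:R) *
        (ln ((3 + S + A + O + H + K)%:R)) ^+ c)%:E)%E.
Proof.
exists 11, 1%N; split=> // St Ac Ob H d Theta nu M r planner vM mM r01 opt K; lazy zeta.
set S := #|{: St}|; set A := #|{: Ac}|; set O := #|{: Ob}|.
rewrite expr1; set D := (S ^ 2 * A + S * O)%N; set X := (3 + S + A + O + H + K)%N.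
have l_ge0 : 0 <= ln X%:R :> R by rewrite ln_ge0// ler1n.
have bound_ge0 : 0 <= 11 * H%:R ^+ 2 * Num.sqrt (D * (O * A) ^ H * K)%:R * ln X%:R :> R.
  by rewrite !mulr_ge0// ?sqrtr_ge0// exprn_ge0.
have [H0|H0] := posnP H.
  rewrite BReg_PS_value0 ?lee_fin// => th pi; subst H.
  by rewrite /value big1// => t _; rewrite big_ord0 mulr0.
(* Without actions there is no trajectory, the horizon being positive. *)
have [A0|A0] := posnP A.
  rewrite BReg_PS_value0 ?lee_fin// => th pi; rewrite /value big1// => t _.
  by have := fintype0 (t (Ordinal H0)).2; rewrite -/A A0 => /(_ erefl).
rewrite (BReg_PSE nu vM mM r01 opt H0 A0) lee_fin.
set reg := Ex _ _.
have [K0|K0] := posnP K.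
  suff -> : reg = 0 by [].
  rewrite /reg -[RHS](Ex_cst nu 0); apply: eq_Ex => th.
  by rewrite K0 /cumreg /= big_nil mulr0.
have [th0 _] := probability_inhabited nu.
have S0 : (0 < S)%N by exact: is_distr_inhabited (vM th0).1.
have [s0 _] := card_gt0P S0.
have O0 : (0 < O)%N by exact: is_distr_inhabited ((vM th0).2.2 (Ordinal H0) s0).
(* This resolution makes the exponent in [model_cover] equal to [1 / K], a factor [e] in total over
   the [K] episodes. *)
pose n := (3 * H * K * (S + O))%N.
have n0 : (0 < n)%N by rewrite !muln_gt0 H0 K0 addn_gt0 S0.
have D0 : (0 < D)%N by rewrite addn_gt0 !muln_gt0 S0 A0.
have N0 : (0 < (O * A) ^ H)%N by rewrite expn_gt0 muln_gt0 O0 A0.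
have KR0 : 0 < K%:R :> R by rewrite ltr0n.
have DR0 : 0 < D%:R :> R by rewrite ltr0n.
have NR0 : 0 < ((O * A) ^ H)%:R :> R by rewrite ltr0n.
have HR1 : 1 <= H%:R :> R by rewrite ler1n.
have DR1 : 1 <= D%:R :> R by rewrite ler1n.
have l1 : 1 <= ln X%:R :> R.
  rewrite -[leLHS]expRK ler_ln ?posrE ?expR_gt0 ?ltr0n//.
  by rewrite (le_trans (expR1_le4 R))// ler_nat /X; lia.
have lnI := ln_card_model_grid_le R S0 A0 O0 H0 K0.
rewrite -/n -/D -/X in lnI.
(* The 10 collects 8 from the logarithm of the grid size, 1 from [a * K = 1] and 1 from the additive
   constant, the last two being at most [H * D * ln X]. *)
have main lam : 0 < lam -> reg <= H%:R *
    (lam * ((O * A) ^ H)%:R * K%:R + (10 * H%:R * D%:R * ln X%:R) / lam).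
  move=> lam0.
  have a0 : 0 <= K%:R^-1 :> R by rewrite invr_ge0 ltW.
  have := @regret_bound R d Theta nu (policy Ac Ob H) (traj Ac Ob H) (@agrees Ac Ob H)
    (fun th => Prminus (M th)) planner (fun t => \sum_(h : 'I_H) r h (t h).1 (t h).2) H%:R
    (Pm01 vM H0 A0) (mPm mM) (mplanner opt) (fun th pi => sum_Prpi pi H0 A0 (vM th))
    (rho_bound r01).
  move=> /(_ _ (ler0n _ _) (model_grid (St := St) (Ac := Ac) (Ob := Ob) (H := H) n)
    (fun i => Prminus (grid_model i : model R St Ac Ob H)) K%:R^-1).
  move=> rb; apply: (le_trans (rb _ _ _ _ K lam a0 lam0)).
  - by move=> th pi; rewrite -(pregE vM r01 opt H0 A0) subr_ge0 (optvalueE vM r01 opt H0 A0); case: opt.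
  - by move=> i t; apply: Prminus_ge0; exact: grid_model_valid.
  - by move=> i pi; apply: sum_Prpi => //; exact: grid_model_valid.
  - move=> th; have [i iP] := model_cover n0 (vM th); exists i => t.
    apply: le_trans (iP t) _; rewrite le_eqVlt; apply/orP; left; apply/eqP.
    congr (expR _ * _); rewrite /n !natrM; field.
    by rewrite !gt_eqF ?ltr0n ?addn_gt0 ?S0 -?natrD ?ltr0n ?addn_gt0 ?S0.
  rewrite ler_wpM2l// card_ffun card_prod card_ord -/O -/A lerD2l.
  apply: ler_wpM2r; first by rewrite invr_ge0 ltW.
  rewrite card_model_grid -/S -/A -/O mulVf ?gt_eqF//.
  have : 1 <= H%:R * D%:R * ln X%:R :> R by rewrite !mulr_ege1.
  by move: lnI; lra.
pose q : R := Num.sqrt (D * (O * A) ^ H * K)%:R.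
have q2 : q ^+ 2 = D%:R * ((O * A) ^ H)%:R * K%:R by rewrite sqr_sqrtr// !natrM.
have q0 : 0 < q by rewrite sqrtr_gt0 ltr0n !muln_gt0 D0 N0 K0.
rewrite -/q.
have HR0 : 0 < H%:R :> R by rewrite ltr0n.
have lR0 : 0 < ln X%:R :> R by exact: lt_le_trans l1.
(* With [q ^+ 2] the product of [D], the number of trajectories and [K], this [lam] gives the two
   terms [H * ln X * q] and [10 * q]; as [1 <= H * ln X], they add up to at most
   [11 * H * ln X * q]. *)
have lam0 : 0 < H%:R * ln X%:R * q / (((O * A) ^ H)%:R * K%:R) by rewrite divr_gt0 ?mulr_gt0.
apply: le_trans (main _ lam0) _.
have -> : H%:R * ln X%:R * q / (((O * A) ^ H)%:R * K%:R) * ((O * A) ^ H)%:R * K%:R =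
    H%:R * ln X%:R * q by field; rewrite !gt_eqF.
have -> : 10 * H%:R * D%:R * ln X%:R / (H%:R * ln X%:R * q / (((O * A) ^ H)%:R * K%:R)) = 10 * q.
  transitivity (10 * (D%:R * ((O * A) ^ H)%:R * K%:R) / q); first by field; rewrite !gt_eqF.
  by rewrite -q2; field; rewrite gt_eqF.
rewrite (_ : 11 * _ * _ * _ = H%:R * (H%:R * ln X%:R * q + 10 * (H%:R * ln X%:R) * q)); last by ring.
rewrite ler_wpM2l// lerD2l; apply: ler_wpM2r; first exact: ltW.
by rewrite ler_peMr// mulr_ege1.
Qed.
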